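(* Hochschild-Mitchell homology and cohomology are Morita invariant: let $k$ be a field and let $\mathcal{C}$ and $\mathcal{D}$ be Morita equivalent small $k$-linear categories. Then there is a $k$-linear equivalence $\Theta$ from the category of $\mathcal{D}$-bimodules to the category of $\mathcal{C}$-bimodules, with $\Theta(\mathcal{D})\simeq\mathcal{C}$, such that for every $\mathcal{D}$-bimodule $M$ and every $n\geq 0$ there are isomorphisms of $k$-vector spaces, natural in $M$, $$H^n(\mathcal{C},\Theta M)\simeq H^n(\mathcal{D},M),\qquad H_n(\mathcal{C},\Theta M)\simeq H_n(\mathcal{D},M).$$
   Context: For a small $k$-linear category $\mathcal{C}$, $\mathcal{C}_0$ is its set of objects and ${}_y\mathcal{C}_x$ the space of morphisms from $x$ to $y$. A left $\mathcal{C}$-module is a $k$-linear covariant functor from $\mathcal{C}$ to $k$-vector spaces. Two $k$-linear categories are Morita equivalent if their categories of left modules are equivalent (as $k$-linear categories). A $\mathcal{C}$-bimodule is a left module over $\mathcal{C}^e=\mathcal{C}\boxtimes\mathcal{C}^{op}$, i.e. a family $({}_yM_x)_{x,y\in\mathcal{C}_0}$ of vector spaces with commuting associative unital left and right actions of the morphisms of $\mathcal{C}$; $\mathcal{C}$ itself is a $\mathcal{C}$-bimodule. Hochschild-Mitchell cohomology $H^\bullet(\mathcal{C},M)$ is the cohomology of $C^n(\mathcal{C},M)=\prod_{(x_{n+1},\dots,x_1)}\mathrm{Hom}_k({}_{x_{n+1}}\mathcal{C}_{x_n}\otimes\cdots\otimes{}_{x_2}\mathcal{C}_{x_1},{}_{x_{n+1}}M_{x_1})$,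 $C^0=\prod_x{}_xM_x$, with the usual Hochschild differential. Hochschild-Mitchell homology $H_\bullet(\mathcal{C},M)$ is the homology of $C_n(\mathcal{C},M)=\bigoplus_{(x_{n+1},\dots,x_1)}{}_{x_1}M_{x_{n+1}}\otimes{}_{x_{n+1}}\mathcal{C}_{x_n}\otimes\cdots\otimes{}_{x_2}\mathcal{C}_{x_1}$, $C_0=\bigoplus_x{}_xM_x$, with the usual Hochschild differential. *)

(* Defs.v *)
From HB Require Import structures.
From mathcomp Require Import all_boot all_algebra.
From mathcomp Require Import finmap boolp prodnormedzmodule.
From mathcomp Require Import monalg.

Set Implicit Arguments.
Unset Strict Implicit.
Unset Printing Implicit Defensive.

Import GRing.Theory.
Local Open Scope ring_scope.
Local Open Scope quotient_scope.
#[local] Obligation Tactic := idtac.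

Definition dprod (I : Type) (V : I -> Type) := forall i, V i.
Identity Coercion dprod_fun : dprod >-> Funclass.

Section Dprod.
Variables (k : fieldType) (I : Type) (V : I -> lmodType k).
Local Notation T := (dprod V).

HB.instance Definition _ := gen_eqMixin T.
HB.instance Definition _ := gen_choiceMixin T.

Let add (f g : T) : T := fun i => f i + g i.
Let opp (f : T) : T := fun i => - f i.
Let zero : T := fun i => 0.
Let scale (a : k) (f : T) : T := fun i => a *: f i.

Fact dprod_addA : associative add.
Proof. by move=> f g h; apply: functional_extensionality_dep => i; apply: addrA. Qed.
Fact dprod_addC : commutative add.
Proof. by move=> f g; apply: functional_extensionality_dep => i; apply: addrC. Qed.
Fact dprod_add0 : left_id zero add.
Proof. by move=> f; apply: functional_extensionality_dep => i; apply: add0r. Qed.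
Fact dprod_addN : left_inverse zero opp add.
Proof. by move=> f; apply: functional_extensionality_dep => i; apply: addNr. Qed.

HB.instance Definition _ :=
  GRing.isZmodule.Build T dprod_addA dprod_addC dprod_add0 dprod_addN.

Fact dprod_scaleA a b (f : T) : scale a (scale b f) = scale (a * b) f.
Proof. by apply: functional_extensionality_dep => i; apply: scalerA. Qed.
Fact dprod_scale1 : left_id 1 scale.
Proof. by move=> f; apply: functional_extensionality_dep => i; apply: scale1r. Qed.
Fact dprod_scaleDr : right_distributive scale +%R.
Proof. by move=> a f g; apply: functional_extensionality_dep => i; apply: scalerDr. Qed.
Fact dprod_scaleDl (f : T) : {morph scale^~ f : a b / a + b}.
Proof. by move=> a b; apply: functional_extensionality_dep => i; apply: scalerDl. Qed.

HB.instance Definition _ := GRing.Zmodule_isLmodule.Build k T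
  dprod_scaleA dprod_scale1 dprod_scaleDr dprod_scaleDl.

Lemma dprodDE (f g : T) i : (f + g) i = f i + g i. Proof. by []. Qed.
Lemma dprodZE a (f : T) i : (a *: f) i = a *: f i. Proof. by []. Qed.
Lemma dprod0E i : (0 : T) i = 0. Proof. by []. Qed.

End Dprod.

Section LinearMaps.
Variables (k : fieldType) (U V : lmodType k).
Local Notation T := {linear U -> V}.

Lemma linear_ext (f g : T) : f =1 g -> f = g.
Proof.
case: f g => [f [[pf] [qf]]] [g [[pg] [qg]]] /= e.
have {}e : f = g by apply: funext.
subst g; do 2 f_equal; f_equal; exact: Prop_irrelevance.
Qed.

Let add (f g : T) : T := (f : U -> V) \+ g.
Let opp (f : T) : T := \- (f : U -> V).
Let zero : T := \0.
Let scale (a : k) (f : T) : T := a \*: (f : U -> V).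

Fact linear_addA : associative add.
Proof. by move=> f g h; apply: linear_ext => i; apply: addrA. Qed.
Fact linear_addC : commutative add.
Proof. by move=> f g; apply: linear_ext => i; apply: addrC. Qed.
Fact linear_add0 : left_id zero add.
Proof. by move=> f; apply: linear_ext => i; apply: add0r. Qed.
Fact linear_addN : left_inverse zero opp add.
Proof. by move=> f; apply: linear_ext => i; apply: addNr. Qed.

HB.instance Definition _ :=
  GRing.isZmodule.Build T linear_addA linear_addC linear_add0 linear_addN.

Fact linear_scaleA a b (f : T) : scale a (scale b f) = scale (a * b) f.
Proof. by apply: linear_ext => i; apply: scalerA. Qed.
Fact linear_scale1 : left_id 1 scale.
Proof. by move=> f; apply: linear_ext => i; apply: scale1r. Qed.
Fact linear_scaleDr : right_distributive scale +%R.
Proof. by move=> a f g; apply: linear_ext => i; apply: scalerDr. Qed.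
Fact linear_scaleDl (f : T) : {morph scale^~ f : a b / a + b}.
Proof. by move=> a b; apply: linear_ext => i; apply: scalerDl. Qed.

HB.instance Definition _ := GRing.Zmodule_isLmodule.Build k T
  linear_scaleA linear_scale1 linear_scaleDr linear_scaleDl.

Lemma linearDE (f g : T) u : (f + g) u = f u + g u. Proof. by []. Qed.
Lemma linearZE a (f : T) u : (a *: f) u = a *: f u. Proof. by []. Qed.

End LinearMaps.

Section QuotientType.
Variables (k : fieldType) (V : lmodType k) (S : submodClosed V).
Definition zmod_pred : {pred V} := S.
Fact zmod_pred_closed : zmod_closed zmod_pred.
Proof.
case: (submodClosedP S) => S0 Sl; split=> // u v Su Sv.
by rewrite addrC -scaleN1r; apply: Sl.
Qed.
HB.instance Definition _ := GRing.isZmodClosed.Build V zmod_pred zmod_pred_closed.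
(* ring_quotient provides V / S as an additive group only *)
Definition quotl : Type := Quotient.quot zmod_pred.
End QuotientType.

Section Quotient.
Variables (k : fieldType) (V : lmodType k) (S : submodClosed V).

HB.instance Definition _ := GRing.Zmodule.on (quotl S).

Definition qclass (v : V) : quotl S := \pi_(Quotient.quot (zmod_pred S)) v.
Definition qrepr (q : quotl S) : V := repr (q : Quotient.quot (zmod_pred S)).

Lemma qreprK q : qclass (qrepr q) = q.
Proof. exact: reprK. Qed.

Lemma qclass_eqP u v : qclass u = qclass v <-> u - v \in S.
Proof.
by split=> [/eqP|uv]; [|apply/eqP]; rewrite /qclass -Quotient.idealrBE.
Qed.

Lemma qclassD u v : qclass (u + v) = qclass u + qclass v.
Proof. exact: (raddfD (\pi_(Quotient.quot (zmod_pred S)))). Qed.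

Let scale (a : k) (q : quotl S) : quotl S := qclass (a *: qrepr q).

Lemma qclassZ_subproof a v : qclass (a *: v) = scale a (qclass v).
Proof.
by apply/qclass_eqP; rewrite -scalerBr rpredZ //; apply/qclass_eqP; rewrite qreprK.
Qed.

Fact quotl_scaleA a b q : scale a (scale b q) = scale (a * b) q.
Proof. by rewrite -[q]qreprK -!qclassZ_subproof scalerA. Qed.
Fact quotl_scale1 : left_id 1 scale.
Proof. by move=> q; rewrite -[q]qreprK -!qclassZ_subproof scale1r. Qed.
Fact quotl_scaleDr : right_distributive scale +%R.
Proof.
move=> a q r; rewrite -[q]qreprK -[r]qreprK -qclassD -!qclassZ_subproof.
by rewrite scalerDr qclassD.
Qed.
Fact quotl_scaleDl q : {morph scale^~ q : a b / a + b}.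
Proof.
by move=> a b; rewrite -[q]qreprK -!qclassZ_subproof scalerDl qclassD.
Qed.

HB.instance Definition _ := GRing.Zmodule_isLmodule.Build k (quotl S)
  quotl_scaleA quotl_scale1 quotl_scaleDr quotl_scaleDl.

Fact qclass_is_linear : linear qclass.
Proof. by move=> a u v; rewrite qclassD qclassZ_subproof. Qed.
HB.instance Definition _ :=
  GRing.isLinear.Build k V (quotl S) *:%R qclass qclass_is_linear.

End Quotient.

Section QuotientMap.
Variables (k : fieldType) (V W : lmodType k).
Variables (S : submodClosed V) (T : submodClosed W) (f : {linear V -> W}).
Hypothesis fST : forall v, v \in S -> f v \in T.

Definition qmap_fun (q : quotl S) : quotl T := qclass T (f (qrepr q)).

Lemma qmap_funE v : qmap_fun (qclass S v) = qclass T (f v).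
Proof.
by apply/qclass_eqP; rewrite -linearB fST //; apply/qclass_eqP; rewrite qreprK.
Qed.

Fact qmap_is_linear : linear qmap_fun.
Proof.
move=> a q r; rewrite -[q]qreprK -[r]qreprK -linearP !qmap_funE.
by rewrite !linearP.
Qed.
HB.instance Definition _ :=
  GRing.isLinear.Build k (quotl S) (quotl T) *:%R qmap_fun qmap_is_linear.
Definition qmap : {linear quotl S -> quotl T} := qmap_fun.

Lemma qmapE v : qmap (qclass S v) = qclass T (f v).
Proof. exact: qmap_funE. Qed.

End QuotientMap.

Section Span.
Variables (k : fieldType) (V : lmodType k) (R : V -> Prop).

Inductive in_span : V -> Prop :=
| in_span0 : in_span 0
| in_spanP a u v : R u -> in_span v -> in_span (a *: u + v).

Definition span_pred : {pred V} := fun v => `[< in_span v >].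

Fact span_closed : submod_closed span_pred.
Proof.
split=> [|a u v /asboolP Su /asboolP Sv]; apply/asboolP; first exact: in_span0.
elim: Su => [|b w u' Rw _ IH]; first by rewrite scaler0 add0r.
by rewrite scalerDr scalerA -addrA; apply: in_spanP.
Qed.
HB.instance Definition _ := GRing.isSubmodClosed.Build k V span_pred span_closed.
Definition lspan : submodClosed V := span_pred.

Lemma lspan_rel v : R v -> v \in lspan.
Proof.
by move=> Rv; apply/asboolP; rewrite -[v]addr0 -[v]scale1r;
  apply: in_spanP => //; apply: in_span0.
Qed.

End Span.

Section SpanMap.
Variables (k : fieldType) (V W : lmodType k) (R : V -> Prop).
Variables (T : submodClosed W) (f : {linear V -> W}).
Lemma lspan_map :
  (forall v, R v -> f v \in T) -> forall v, v \in lspan R -> f v \in T.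
Proof.
move=> RT v /asboolP; elim=> [|a u w Ru _ IH]; first by rewrite linear0 rpred0.
by rewrite linearP rpredD // rpredZ // RT.
Qed.
End SpanMap.

Section FreeMap.
Variables (k : fieldType) (K : choiceType) (V : lmodType k) (f : K -> V).

Definition free_map_fun (g : {malg k[K]}) : V :=
  \sum_(w <- msupp g) g@_w *: f w.

Lemma free_mapEw (g : {malg k[K]}) (d : {fset K}) :
  (msupp g `<=` d)%fset -> free_map_fun g = \sum_(w <- d) g@_w *: f w.
Proof.
move=> sgd; rewrite /free_map_fun (big_fset_incl _ sgd) // => w _ wg.
by rewrite mcoeff_outdom // scale0r.
Qed.

Fact free_map_is_linear : linear free_map_fun.
Proof.
move=> a g h; set d := (msupp g `|` msupp h)%fset.
have dg : (msupp g `<=` d)%fset by apply: fsubsetUl.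
have dh : (msupp h `<=` d)%fset by apply: fsubsetUr.
rewrite (free_mapEw dg) (free_mapEw dh) (@free_mapEw _ d); last first.
  apply: fsubset_trans (msuppD_le _ _) _; rewrite fsubUset dh andbT.
  exact: fsubset_trans (msuppZ_le _ _) dg.
rewrite scaler_sumr -big_split; apply: eq_bigr => w _ /=.
by rewrite mcoeffD mcoeffZ scalerDl scalerA.
Qed.
HB.instance Definition _ := GRing.isLinear.Build k {malg k[K]} V *:%R
  free_map_fun free_map_is_linear.
Definition free_map : {linear {malg k[K]} -> V} := free_map_fun.

Lemma free_mapU w : free_map << w >> = f w.
Proof.
rewrite /free_map /= /free_map_fun msuppU oner_eq0 big_seq_fset1.
by rewrite mcoeffUU scale1r.
Qed.

End FreeMap.

Lemma free_ext (k : fieldType) (K : choiceType) (V : lmodType k)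
    (f g : {linear {malg k[K]} -> V}) :
  (forall w, f << w >> = g << w >>) -> f =1 g.
Proof.
move=> fg v; rewrite [v]monalgE !linear_sum; apply: eq_bigr => w _.
have -> : << v@_w *g w >> = v@_w *: << w >> :> {malg k[K]}.
  by apply/malgP => u; rewrite mcoeffZ !mcoeffU mulr_natr.
by rewrite !linearZ fg.
Qed.

Section Homology.
Variables (k : fieldType) (U V W : lmodType k).
Variables (f : {linear U -> V}) (g : {linear V -> W}).

Definition ker_pred : {pred V} := fun v => g v == 0.
Fact ker_closed : submod_closed ker_pred.
Proof.
split=> [|a u v /eqP gu /eqP gv]; apply/eqP; first exact: linear0.
by rewrite linearP gu gv scaler0 addr0.
Qed.
HB.instance Definition _ := GRing.isSubmodClosed.Build k V ker_pred ker_closed.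

Record cycles := Cycle { cycle_val : V; _ : cycle_val \in ker_pred }.
HB.instance Definition _ := [isSub for cycle_val].
HB.instance Definition _ := [Choice of cycles by <:].
HB.instance Definition _ := [SubChoice_isSubLmodule of cycles by <:].

Definition bound_pred : {pred cycles} := fun z => `[< exists u, f u = cycle_val z >].
Fact bound_closed : submod_closed bound_pred.
Proof.
split=> [|a y z /asboolP[u fu] /asboolP[v fv]]; apply/asboolP.
  by exists 0; rewrite linear0.
by exists (a *: u + v); rewrite linearP fu fv.
Qed.
HB.instance Definition _ :=
  GRing.isSubmodClosed.Build k cycles bound_pred bound_closed.

(* ker g / (im f :&: ker g), which is ker g / im f when g \o f = 0 *)
Definition homology : lmodType k := quotl bound_pred.

End Homology.

Arguments bound_pred {k U V W} f g _.

Section HomologyMap.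
Variables (k : fieldType) (U V W U' V' W' : lmodType k).
Variables (f : {linear U -> V}) (g : {linear V -> W}).
Variables (f' : {linear U' -> V'}) (g' : {linear V' -> W'}).
Variables (a : {linear U -> U'}) (b : {linear V -> V'}) (c : {linear W -> W'}).
Hypothesis ab : forall u, b (f u) = f' (a u).
Hypothesis bc : forall v, c (g v) = g' (b v).

Fact cycles_map_proof (z : cycles g) : b (cycle_val z) \in ker_pred g'.
Proof. by case: z => z /= /eqP gz; apply/eqP; rewrite -bc gz linear0. Qed.
Definition cycles_map_fun z : cycles g' := Cycle (cycles_map_proof z).
Fact cycles_map_is_linear : linear cycles_map_fun.
Proof. by move=> e y z; apply: val_inj; rewrite /= linearP. Qed.
HB.instance Definition _ := GRing.isLinear.Build k (cycles g) (cycles g') *:%R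
  cycles_map_fun cycles_map_is_linear.

Fact cycles_map_bound z : z \in bound_pred f g -> cycles_map_fun z \in bound_pred f' g'.
Proof. by move=> /asboolP[u fu]; apply/asboolP; exists (a u); rewrite /= -ab fu. Qed.

Definition homology_map : {linear homology f g -> homology f' g'} :=
  qmap cycles_map_bound.

End HomologyMap.

(* [mor C x y] is the space of morphisms from x to y. The type of objects is
   not bounded by the universe of [lmodType], so that module categories are also
   [lincat]s; [functorcat A B] and [HHco C] do force the objects of A, resp. C,
   into that universe, i.e. they require small categories. *)
Record lincat (k : fieldType) (ob : Type) := LinCat {
  mor : ob -> ob -> lmodType k;
  idm : forall x, mor x x;
  mcomp : forall x y z, mor y z -> mor x y -> mor x z;
  mcomp_linl : forall x y z (f : mor x y), linear (fun g : mor y z => mcomp g f);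
  mcomp_linr : forall x y z (g : mor y z), linear (fun f : mor x y => mcomp g f);
  mcomp1m : forall x y (f : mor x y), mcomp (idm y) f = f;
  mcompm1 : forall x y (f : mor x y), mcomp f (idm x) = f;
  mcompA : forall x y z t (h : mor z t) (g : mor y z) (f : mor x y),
    mcomp h (mcomp g f) = mcomp (mcomp h g) f
}.
Arguments idm {k ob} C x : rename.
Arguments mcomp {k ob} C {x y z} g f : rename.

Lemma linear_fun0 (k : fieldType) (U V : lmodType k) (f : U -> V) :
  linear f -> f 0 = 0.
Proof. by move/(_ (-1) 0 0); rewrite scaler0 addr0 scaleN1r addNr. Qed.

Section CategoryNotions.
Variables (k : fieldType) (ob : Type) (C : lincat k ob).
Definition is_iso (x y : ob) (f : mor C x y) : Prop :=
  exists g : mor C y x, mcomp C g f = idm C x /\ mcomp C f g = idm C y.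
Definition isomorphic (x y : ob) : Prop := exists f : mor C x y, is_iso f.
End CategoryNotions.

Record linfunctor (k : fieldType) (obA obB : Type)
    (A : lincat k obA) (B : lincat k obB) := LinFunctor {
  fob :> obA -> obB;
  fmap : forall x y, {linear mor A x y -> mor B (fob x) (fob y)};
  fmap1 : forall x, fmap x x (idm A x) = idm B (fob x);
  fmap_comp : forall x y z (g : mor A y z) (f : mor A x y),
    fmap x z (mcomp A g f) = mcomp B (fmap y z g) (fmap x y f)
}.
Arguments fmap {k obA obB A B} F {x y} : rename.

Section Functors.
Variable k : fieldType.

Program Definition idfunctor (obA : Type) (A : lincat k obA) : linfunctor A A :=
  @LinFunctor k obA obA A A id (fun x y => idfun) _ _.
Next Obligation. by []. Qed.
Next Obligation. by []. Qed.

Section Comp.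
Variables (obA obB obE : Type).
Variables (A : lincat k obA) (B : lincat k obB) (E : lincat k obE).
Variables (G : linfunctor B E) (F : linfunctor A B).
Program Definition compfunctor : linfunctor A E :=
  @LinFunctor k obA obE A E (fun x => G (F x)) (fun x y => fmap G \o fmap F) _ _.
Next Obligation. by move=> x /=; rewrite !fmap1. Qed.
Next Obligation. by move=> x y z g f /=; rewrite !fmap_comp. Qed.
End Comp.

Section NatIso.
Variables (obA obB : Type) (A : lincat k obA) (B : lincat k obB).

Definition natural (F G : linfunctor A B)
    (t : forall x, mor B (F x) (G x)) : Prop :=
  forall x y (f : mor A x y), mcomp B (fmap G f) (t x) = mcomp B (t y) (fmap F f).

Definition nat_isomorphic (F G : linfunctor A B) : Prop :=
  exists t : forall x, mor B (F x) (G x), natural t /\ forall x, is_iso (t x).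

End NatIso.

Definition is_equivalence (obA obB : Type) (A : lincat k obA) (B : lincat k obB)
    (F : linfunctor A B) : Prop :=
  exists G : linfunctor B A,
    nat_isomorphic (compfunctor G F) (idfunctor A) /\
    nat_isomorphic (compfunctor F G) (idfunctor B).

Program Definition vectcat : lincat k (lmodType k) :=
  @LinCat k (lmodType k) (fun U V => {linear U -> V}) (fun U => idfun)
    (fun U V W g f => (g : V -> W) \o f) _ _ _ _ _.
Next Obligation. by move=> U V W f a g h; apply: linear_ext. Qed.
Next Obligation.
by move=> U V W g a f h; apply: linear_ext => u /=; rewrite linearP.
Qed.
Next Obligation. by move=> U V f; apply: linear_ext. Qed.
Next Obligation. by move=> U V f; apply: linear_ext. Qed.
Next Obligation. by move=> U V W X h g f; apply: linear_ext. Qed.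

Section FunctorCategory.
Variables (obA obB : Type) (A : lincat k obA) (B : lincat k obB).

Section NatTrans.
Variables F G : linfunctor A B.

Definition natural_pred : {pred dprod (fun x => mor B (F x) (G x))} :=
  fun t => `[< natural t >].

Fact natural_closed : submod_closed natural_pred.
Proof.
split=> [|a s t /asboolP ns /asboolP nt]; apply/asboolP => x y f.
  by rewrite (linear_fun0 (mcomp_linr _)) (linear_fun0 (mcomp_linl _)).
by rewrite !dprodDE !dprodZE mcomp_linl mcomp_linr ns nt.
Qed.
HB.instance Definition _ :=
  GRing.isSubmodClosed.Build k _ natural_pred natural_closed.

Record nattrans := NatTrans {
  nt_fun :> dprod (fun x => mor B (F x) (G x));
  _ : nt_fun \in natural_pred
}.
HB.instance Definition _ := [isSub for nt_fun].
HB.instance Definition _ := [Choice of nattrans by <:].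
HB.instance Definition _ := [SubChoice_isSubLmodule of nattrans by <:].

Lemma nattransP (t : nattrans) : natural t.
Proof. by case: t => t /= /asboolP. Qed.
End NatTrans.

Section Comp.
Variables F G H : linfunctor A B.

Fact nattrans_id_proof : (fun x => idm B (F x)) \in @natural_pred F F.
Proof. by apply/asboolP => x y f; rewrite mcomp1m mcompm1. Qed.
Definition nattrans_id : nattrans F F := NatTrans nattrans_id_proof.

Fact nattrans_comp_proof (t : nattrans G H) (s : nattrans F G) :
  (fun x => mcomp B (t x) (s x)) \in @natural_pred F H.
Proof.
apply/asboolP => x y f.
by rewrite mcompA nattransP -mcompA nattransP mcompA.
Qed.
Definition nattrans_comp t s : nattrans F H := NatTrans (nattrans_comp_proof t s).
End Comp.

Lemma nattrans_ext (F G : linfunctor A B) (s t : nattrans F G) :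
  (forall x, s x = t x) -> s = t.
Proof. by move=> st; apply: val_inj; apply: functional_extensionality_dep. Qed.

Program Definition functorcat : lincat k (linfunctor A B) :=
  @LinCat k (linfunctor A B) (fun F G => nattrans F G) nattrans_id
    nattrans_comp _ _ _ _ _.
Next Obligation.
by move=> F G H s a t u; apply: nattrans_ext => x; apply: mcomp_linl.
Qed.
Next Obligation.
by move=> F G H s a t u; apply: nattrans_ext => x; apply: mcomp_linr.
Qed.
Next Obligation. by move=> F G t; apply: nattrans_ext => x; apply: mcomp1m. Qed.
Next Obligation. by move=> F G t; apply: nattrans_ext => x; apply: mcompm1. Qed.
Next Obligation. by move=> F G H K u t s; apply: nattrans_ext => x; apply: mcompA. Qed.

End FunctorCategory.

Section Modules.
Variables (ob : Type) (C : lincat k ob).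
Definition leftmod := linfunctor C vectcat.
Definition leftmodcat : lincat k leftmod := functorcat C vectcat.
End Modules.

Definition morita_equivalent (obC obD : Type)
    (C : lincat k obC) (D : lincat k obD) : Prop :=
  exists F : linfunctor (leftmodcat C) (leftmodcat D), is_equivalence F.

(* [bm M y x] is {}_yM_x: it receives a left action of the morphisms out of y
   and a right action of the morphisms into x. *)
Record bimod (ob : Type) (C : lincat k ob) := Bimod {
  bm : ob -> ob -> lmodType k;
  lact : forall x y z, mor C y z -> bm y x -> bm z x;
  ract : forall x y w, bm y x -> mor C w x -> bm y w;
  lact_linl : forall x y z (m : bm y x), linear (fun f : mor C y z => lact f m);
  lact_linr : forall x y z (f : mor C y z), linear (fun m : bm y x => lact f m);
  ract_linl : forall x y w (g : mor C w x), linear (fun m : bm y x => ract m g);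
  ract_linr : forall x y w (m : bm y x), linear (fun g : mor C w x => ract m g);
  lact1 : forall x y (m : bm y x), lact (idm C y) m = m;
  lactA : forall x y z t (g : mor C z t) (f : mor C y z) (m : bm y x),
    lact (mcomp C g f) m = lact g (lact f m);
  ract1 : forall x y (m : bm y x), ract m (idm C x) = m;
  ractA : forall x y w v (m : bm y x) (f : mor C w x) (g : mor C v w),
    ract m (mcomp C f g) = ract (ract m f) g;
  lractA : forall x y z w (f : mor C y z) (m : bm y x) (g : mor C w x),
    ract (lact f m) g = lact f (ract m g)
}.
Arguments lact {ob C} M {x y z} f m : rename.
Arguments ract {ob C} M {x y w} m g : rename.

Section BimoduleCategory.
Variables (ob : Type) (C : lincat k ob).

Local Notation bfamily M N :=
  (dprod (fun y => dprod (fun x => {linear bm M y x -> bm N y x}))).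

Section BimodMor.
Variables M N : bimod C.
Local Notation T := (bfamily M N).

Definition bimod_morphism (t : T) : Prop :=
  (forall x y z (f : mor C y z) (m : bm M y x),
     t z x (lact M f m) = lact N f (t y x m)) /\
  (forall x y w (m : bm M y x) (g : mor C w x),
     t y w (ract M m g) = ract N (t y x m) g).
Definition bimod_morphism_pred : {pred T} := fun t => `[< bimod_morphism t >].

Fact bimod_morphism_closed : submod_closed bimod_morphism_pred.
Proof.
split=> [|a s t /asboolP[ls rs] /asboolP[lt rt]]; apply/asboolP; split.
- by move=> x y z f m; rewrite !dprod0E /= (linear_fun0 (lact_linr _)).
- by move=> x y w m g; rewrite !dprod0E /= (linear_fun0 (ract_linl _)).
- by move=> x y z f m; rewrite !dprodDE !dprodZE !linearDE !linearZE lact_linr ls lt.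
- by move=> x y w m g; rewrite !dprodDE !dprodZE !linearDE !linearZE ract_linl rs rt.
Qed.
HB.instance Definition _ :=
  GRing.isSubmodClosed.Build k T bimod_morphism_pred bimod_morphism_closed.

Record bimodmor := BimodMor {
  bmor :> T;
  _ : bmor \in bimod_morphism_pred
}.
HB.instance Definition _ := [isSub for bmor].
HB.instance Definition _ := [Choice of bimodmor by <:].
HB.instance Definition _ := [SubChoice_isSubLmodule of bimodmor by <:].

Lemma bimodmorP (t : bimodmor) : bimod_morphism t.
Proof. by case: t => t /= /asboolP. Qed.

Lemma bimodmor_ext (s t : bimodmor) :
  (forall y x m, s y x m = t y x m) -> s = t.
Proof.
move=> st; apply: val_inj; apply: functional_extensionality_dep => y.
apply: functional_extensionality_dep => x; apply: linear_ext => m; exact: st.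
Qed.
End BimodMor.

Section BimodMorComp.
Variables M N P : bimod C.
Fact bimodmor_id_proof : ((fun y x => idfun) : bfamily M M) \in @bimod_morphism_pred M M.
Proof. by apply/asboolP; split. Qed.
Definition bimodmor_id : bimodmor M M := BimodMor bimodmor_id_proof.

Fact bimodmor_comp_proof (t : bimodmor N P) (s : bimodmor M N) :
  ((fun y x => (t y x : bm N y x -> bm P y x) \o s y x) : bfamily M P)
    \in @bimod_morphism_pred M P.
Proof.
case: (bimodmorP s) (bimodmorP t) => ls rs [lt rt].
by apply/asboolP; split=> * /=; rewrite ?ls ?rs ?lt ?rt.
Qed.
Definition bimodmor_comp t s : bimodmor M P := BimodMor (bimodmor_comp_proof t s).
End BimodMorComp.

Program Definition bimodcat : lincat k (bimod C) :=
  @LinCat k (bimod C) (fun M N => bimodmor M N) bimodmor_id bimodmor_comp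
    _ _ _ _ _.
Next Obligation. by move=> M N P s a t u; apply: bimodmor_ext. Qed.
Next Obligation.
by move=> M N P s a t u; apply: bimodmor_ext => y x m /=; rewrite -linearP.
Qed.
Next Obligation. by move=> M N t; apply: bimodmor_ext. Qed.
Next Obligation. by move=> M N t; apply: bimodmor_ext. Qed.
Next Obligation. by move=> M N P Q u t s; apply: bimodmor_ext. Qed.

Program Definition regbimod : bimod C :=
  @Bimod ob C (fun y x => mor C x y) (fun x y z f m => mcomp C f m)
    (fun x y w m g => mcomp C m g) _ _ _ _ _ _ _ _ _.
Next Obligation. by move=> x y z m; apply: mcomp_linl. Qed.
Next Obligation. by move=> x y z f; apply: mcomp_linr. Qed.
Next Obligation. by move=> x y w g; apply: mcomp_linl. Qed.
Next Obligation. by move=> x y w m; apply: mcomp_linr. Qed.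
Next Obligation. by move=> x y m; apply: mcomp1m. Qed.
Next Obligation. by move=> x y z t g f m; apply/esym/mcompA. Qed.
Next Obligation. by move=> x y m; apply: mcompm1. Qed.
Next Obligation. by move=> x y w v m f g; apply: mcompA. Qed.
Next Obligation. by move=> x y z w f m g; apply/esym/mcompA. Qed.

End BimoduleCategory.

Section HomologyFunctor.
Variables (ob : Type) (A : lincat k ob) (F0 F1 F2 : linfunctor A vectcat).
Variables (f : forall M, {linear F0 M -> F1 M}) (g : forall M, {linear F1 M -> F2 M}).
Hypotheses (nf : @natural ob (lmodType k) A vectcat F0 F1 f).
Hypotheses (ng : @natural ob (lmodType k) A vectcat F1 F2 g).

Fact hf_left M N (t : mor A M N) u :
  (fmap F1 t : {linear _ -> _}) (f M u) = f N ((fmap F0 t : {linear _ -> _}) u).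
Proof. exact: (congr1 (fun h : {linear F0 M -> F1 N} => h u) (nf t)). Qed.
Fact hf_right M N (t : mor A M N) u :
  (fmap F2 t : {linear _ -> _}) (g M u) = g N ((fmap F1 t : {linear _ -> _}) u).
Proof. exact: (congr1 (fun h : {linear F1 M -> F2 N} => h u) (ng t)). Qed.

Definition hf_map M N (t : mor A M N) :
    {linear homology (f M) (g M) -> homology (f N) (g N)} :=
  homology_map (hf_left t) (hf_right t).

Lemma hf_mapE M N (t : mor A M N) (z : cycles (g M)) :
  hf_map t (qclass _ z) = qclass _ (cycles_map_fun (hf_right t) z).
Proof. exact: qmapE. Qed.

Fact hf_map_is_linear M N : linear (@hf_map M N).
Proof.
move=> a s t; apply: linear_ext => q; rewrite -[q]qreprK linearDE linearZE !hf_mapE.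
rewrite -[RHS](linearP (@qclass k _ _)); congr qclass; apply: val_inj => /=.
by rewrite linearP.
Qed.
HB.instance Definition _ M N := GRing.isLinear.Build k (mor A M N)
  {linear homology (f M) (g M) -> homology (f N) (g N)} *:%R
  (@hf_map M N) (@hf_map_is_linear M N).

Program Definition homologyF : linfunctor A vectcat :=
  @LinFunctor k ob (lmodType k) A vectcat
    (fun M => homology (f M) (g M)) hf_map _ _.
Next Obligation.
move=> M; apply: linear_ext => q; rewrite -[q]qreprK hf_mapE.
by congr qclass; apply: val_inj; rewrite /= fmap1.
Qed.
Next Obligation.
move=> M N P t s; apply: linear_ext => q; rewrite -(qreprK q).
move: (qrepr q) => z; transitivity (hf_map t (hf_map s (qclass _ z))) => //.
by rewrite !hf_mapE; congr qclass; apply: val_inj; rewrite /= fmap_comp.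
Qed.
End HomologyFunctor.

Section Hochschild.
Variables (ob : Type) (C : lincat k ob).

(* [chain x n z]: composable tuples (c_n, ..., c_1) of morphisms
   x = x_1 -> x_2 -> ... -> x_{n+1} = z, the intermediate objects varying. *)
Inductive chain (x : ob) : nat -> ob -> Type :=
| chain0 : chain x 0 x
| chainS n y z (f : mor C y z) (c : chain x n y) : chain x n.+1 z.

(* [chlin a c1 c2 c3]: the three chains agree except in one slot, where the
   entries are f, g and a *: f + g respectively. *)
Inductive chlin (a : k) (x : ob) :
    forall n z, chain x n z -> chain x n z -> chain x n z -> Prop :=
| chlin_head n y z (f g : mor C y z) (c : chain x n y) :
    chlin a (chainS f c) (chainS g c) (chainS (a *: f + g) c)
| chlin_tail n y z (f : mor C y z) (c1 c2 c3 : chain x n y) :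
    chlin a c1 c2 c3 -> chlin a (chainS f c1) (chainS f c2) (chainS f c3).

(* (c_{n+1}, ..., c_1) |-> c_{n+1}, (c_n, ..., c_1) *)
Definition chfirst x n z (c : chain x n.+1 z) :
    {y : ob & (mor C y z * chain x n y)%type} :=
  match c in chain _ m z return
    match m with 0 => unit | m'.+1 => {y : ob & (mor C y z * chain x m' y)%type} end
  with
  | chain0 => tt
  | chainS _ y _ f c' => existT _ y (f, c')
  end.

Definition chlast_type x n z : Type :=
  match n with 0 => unit | n'.+1 => {w : ob & (chain w n' z * mor C x w)%type} end.

(* (c_{n+1}, ..., c_1) |-> (c_{n+1}, ..., c_2), c_1 *)
Fixpoint chlast x n z (c : chain x n z) : chlast_type x n z :=
  match c in chain _ n z return chlast_type x n z with
  | chain0 => tt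
  | chainS n y z f c' =>
    match c' in chain _ n y return
      mor C y z -> chlast_type x n y -> chlast_type x n.+1 z
    with
    | chain0 => fun f _ => existT _ z (chain0 z, f)
    | chainS _ _ _ _ _ => fun f r =>
        let: existT w (d, g) := r in existT _ w (chainS f d, g)
    end f (chlast c')
  end.

(* the chains (c_n, ..., c_{j+1} c_j, ..., c_1) for j = n-1, ..., 1 *)
Fixpoint merges x n z (c : chain x n z) : seq (chain x n.-1 z) :=
  match c in chain _ n z return seq (chain x n.-1 z) with
  | chain0 => [::]
  | chainS n y z f c' =>
    match c' in chain _ n y return
      mor C y z -> seq (chain x n.-1 y) -> seq (chain x n z)
    with
    | chain0 => fun _ _ => [::]
    | chainS _ _ _ g c'' => fun f r =>
        chainS (mcomp C f g) c'' :: [seq chainS f d | d <- r]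
    end f (merges c')
  end.

Lemma size_merges x n z (c : chain x n z) : size (merges c) = n.-1.
Proof.
elim: c => //= {}n y {}z f c; case: c f => //= {}n w {}y g c f.
by rewrite size_map => ->.
Qed.

Inductive chfirst_lin a x n z :
  forall c1 c2 c3 : {y : ob & (mor C y z * chain x n y)%type}, Prop :=
| chfirst_lin_head y f g c : chfirst_lin a
    (existT _ y (f, c)) (existT _ y (g, c)) (existT _ y (a *: f + g, c))
| chfirst_lin_tail y f c1 c2 c3 : chlin a c1 c2 c3 -> chfirst_lin a
    (existT _ y (f, c1)) (existT _ y (f, c2)) (existT _ y (f, c3)).

Lemma chfirst_chlin a x n z (c1 c2 c3 : chain x n.+1 z) :
  chlin a c1 c2 c3 -> chfirst_lin a (chfirst c1) (chfirst c2) (chfirst c3).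
Proof.
move=> h.
pose P m z := match m return chain x m z -> chain x m z -> chain x m z -> Prop with
  | 0 => fun _ _ _ => True
  | m'.+1 => fun c1 c2 c3 => chfirst_lin a (chfirst c1) (chfirst c2) (chfirst c3)
  end.
suff : P n.+1 z c1 c2 c3 by [].
by case: h => [m y t f g c|m y t f d1 d2 d3 h]; constructor.
Qed.

Inductive chlast_lin a x n z :
  forall c1 c2 c3 : {w : ob & (chain w n z * mor C x w)%type}, Prop :=
| chlast_lin_head w c f g : chlast_lin a
    (existT _ w (c, f)) (existT _ w (c, g)) (existT _ w (c, a *: f + g))
| chlast_lin_tail w c1 c2 c3 f : chlin a c1 c2 c3 -> chlast_lin a
    (existT _ w (c1, f)) (existT _ w (c2, f)) (existT _ w (c3, f)).

Lemma chlastS x n y z (f : mor C y z) (c : chain x n.+1 y) :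
  chlast (chainS f c) = let: existT w (d, e) := chlast c in existT _ w (chainS f d, e).
Proof.
pose P m y := match m return chain x m y -> Prop with
  | 0 => fun _ => True
  | m'.+1 => fun c => forall f : mor C y z, chlast (chainS f c) =
      let: existT w (d, e) := chlast c in existT _ w (chainS f d, e)
  end.
suff : P n.+1 y c by apply.
by case: c.
Qed.

Lemma chlast_chlin a x n z (c1 c2 c3 : chain x n.+1 z) :
  chlin a c1 c2 c3 -> chlast_lin a (chlast c1) (chlast c2) (chlast c3).
Proof.
pose P m z := match m return chain x m z -> chain x m z -> chain x m z -> Prop with
  | 0 => fun _ _ _ => True
  | m'.+1 => fun c1 c2 c3 => chlast_lin a (chlast c1) (chlast c2) (chlast c3)
  end.
move=> h; suff : P n.+1 z c1 c2 c3 by [].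
elim: h => {n z c1 c2 c3} [[|n] y z f g c|[|n] y z f c1 c2 c3 h IH] /=.
- pose R m y := match m return chain x m y -> Prop with
    | 0 => fun c => forall f g : mor C y z, chlast_lin a
       (chlast (chainS f c)) (chlast (chainS g c)) (chlast (chainS (a *: f + g) c))
    | _ => fun _ => True
    end.
  suff : R 0%N y c by apply.
  by case: c {f g} => // f g; apply: chlast_lin_head.
- rewrite -!/(chlast (chainS _ _)) !chlastS; case: (chlast c) => w [d e].
  by apply: chlast_lin_tail; apply: chlin_head.
- by inversion h.
rewrite -!/(chlast (chainS _ _)) !chlastS.
case: IH => [w c e g|w d1 d2 d3 e hd]; first exact: chlast_lin_head.
by apply: chlast_lin_tail; apply: chlin_tail.
Qed.

Inductive all3 (T : Type) (R : T -> T -> T -> Prop) :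
    seq T -> seq T -> seq T -> Prop :=
| all3_nil : all3 R [::] [::] [::]
| all3_cons t1 t2 t3 s1 s2 s3 : R t1 t2 t3 -> all3 R s1 s2 s3 ->
    all3 R (t1 :: s1) (t2 :: s2) (t3 :: s3).

Lemma all3_map (T U : Type) (R : T -> T -> T -> Prop) (Q : U -> U -> U -> Prop)
    (f1 f2 f3 : T -> U) s1 s2 s3 :
  (forall t1 t2 t3, R t1 t2 t3 -> Q (f1 t1) (f2 t2) (f3 t3)) ->
  all3 R s1 s2 s3 -> all3 Q (map f1 s1) (map f2 s2) (map f3 s3).
Proof. by move=> RQ; elim=> [|t1 t2 t3 {}s1 {}s2 {}s3 h _ IH]; constructor; auto. Qed.

Lemma all3_diag (T U : Type) (Q : U -> U -> U -> Prop) (f1 f2 f3 : T -> U) s :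
  (forall t, Q (f1 t) (f2 t) (f3 t)) -> all3 Q (map f1 s) (map f2 s) (map f3 s).
Proof. by move=> h; elim: s => [|t s IH]; constructor; auto. Qed.

Lemma merges_chlin a x n z (c1 c2 c3 : chain x n z) :
  chlin a c1 c2 c3 -> all3 (@chlin a x n.-1 z) (merges c1) (merges c2) (merges c3).
Proof.
elim=> {n z c1 c2 c3} [n y z f g c|n y z f c1 c2 c3 h].
  case: c f g => [|{}n w {}y h c] f g /=; first exact: all3_nil.
  apply: all3_cons; first by rewrite mcomp_linl; apply: chlin_head.
  by apply: all3_diag => t; apply: chlin_head.
case: h f => {n y c1 c2 c3} [n w y g h c|n w y g c1 c2 c3 h] f IH /=.
  apply: all3_cons; first by rewrite mcomp_linr; apply: chlin_head.
  by apply: (all3_map _ IH) => *; apply: chlin_tail.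
apply: all3_cons; first exact: chlin_tail.
by apply: (all3_map _ IH) => *; apply: chlin_tail.
Qed.

Lemma altsum_lin (V : lmodType k) n (s1 s2 s3 : seq V) (a : k) :
  all3 (fun v1 v2 v3 => v3 = a *: v1 + v2) s1 s2 s3 ->
  \sum_(i < n) (-1) ^+ i.+1 *: s3`_i =
  a *: (\sum_(i < n) (-1) ^+ i.+1 *: s1`_i) + \sum_(i < n) (-1) ^+ i.+1 *: s2`_i.
Proof.
move=> h; have hn : forall i, s3`_i = a *: s1`_i + s2`_i.
  elim: h => [|t1 t2 t3 {}s1 {}s2 {}s3 -> _ IH] [|i] //=.
    by rewrite scaler0 addr0.
  by rewrite scaler0 addr0.
rewrite scaler_sumr -big_split; apply: eq_bigr => i _ /=.
by rewrite hn scalerDr !scalerA mulrC.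
Qed.

Section Cochains.
Variables (M : bimod C) (n : nat).

Local Notation T :=
  (dprod (fun x => dprod (fun z => dprod (fun _ : chain x n z => bm M z x)))).

(* A linear map out of a tensor product is a multilinear map; the product over
   (x_{n+1}, ..., x_1) is that over x = x_1, z = x_{n+1} and the intermediate
   objects recorded in the chain. For n = 0 there is no slot, and chains force
   z = x, so that C^0 is the product of the {}_xM_x. *)
Definition multilinear (phi : T) : Prop :=
  forall a x z (c1 c2 c3 : chain x n z),
    chlin a c1 c2 c3 -> phi x z c3 = a *: phi x z c1 + phi x z c2.
Definition cochain_pred : {pred T} := fun phi => `[< multilinear phi >].

Fact cochain_closed : submod_closed cochain_pred.
Proof.
split=> [|b s t /asboolP hs /asboolP ht]; apply/asboolP => a x z c1 c2 c3 h.
  by rewrite !dprod0E scaler0 addr0.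
rewrite !dprodDE !dprodZE (hs _ _ _ _ _ _ h) (ht _ _ _ _ _ _ h).
by rewrite !scalerDr !scalerA [b * a]mulrC addrACA.
Qed.
HB.instance Definition _ :=
  GRing.isSubmodClosed.Build k T cochain_pred cochain_closed.

Record cochain := Cochain { cofun :> T; _ : cofun \in cochain_pred }.
HB.instance Definition _ := [isSub for cofun].
HB.instance Definition _ := [Choice of cochain by <:].
HB.instance Definition _ := [SubChoice_isSubLmodule of cochain by <:].

Lemma cochainP (phi : cochain) : multilinear phi.
Proof. by case: phi => phi /= /asboolP. Qed.

Lemma cochain_ext (phi psi : cochain) :
  (forall x z c, phi x z c = psi x z c) -> phi = psi.
Proof.
move=> e; apply: val_inj; apply: functional_extensionality_dep => x.
apply: functional_extensionality_dep => z.
by apply: functional_extensionality_dep => c.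
Qed.
End Cochains.

Section Coboundary.
Variables (M : bimod C) (n : nat).

(* (d phi)(c_{n+1}, ..., c_1) = c_{n+1} phi(c_n, ..., c_1)
     + sum_{i=1}^n (-1)^i phi(..., c_{n+2-i} c_{n+1-i}, ...)
     + (-1)^{n+1} phi(c_{n+1}, ..., c_2) c_1 *)
Definition cobound_fun (phi : cochain M n) x z (c : chain x n.+1 z) : bm M z x :=
  (let: existT y (f, c') := chfirst c in lact M f (phi x y c'))
  + \sum_(i < n) (-1) ^+ i.+1 *: [seq phi x z c' | c' <- merges c]`_i
  + (-1) ^+ n.+1 *: (let: existT w (c', g) := chlast c in ract M (phi w z c') g).

Fact cobound_proof (phi : cochain M n) : cobound_fun phi \in @cochain_pred M n.+1.
Proof.
apply/asboolP => a x z c1 c2 c3 h; rewrite /cobound_fun.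
have hs : all3 (fun v1 v2 v3 => v3 = a *: v1 + v2)
    [seq phi x z c' | c' <- merges c1] [seq phi x z c' | c' <- merges c2]
    [seq phi x z c' | c' <- merges c3].
  by apply: (all3_map _ (merges_chlin h)) => d1 d2 d3; apply: cochainP.
rewrite (altsum_lin _ hs) !scalerDr.
rewrite [RHS]addrACA; congr (_ + _); first rewrite [RHS]addrACA; first congr (_ + _).
  case: (chfirst_chlin h) => [y f g c|y f d1 d2 d3 hd]; first exact: lact_linl.
  by rewrite (cochainP phi hd) lact_linr.
rewrite scalerA [a * _]mulrC -scalerA -scalerDr; congr (_ *: _).
case: (chlast_chlin h) => [w c f g|w d1 d2 d3 f hd]; first exact: ract_linr.
by rewrite (cochainP phi hd) ract_linl.
Qed.
Definition cobound phi : cochain M n.+1 := Cochain (cobound_proof phi).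

Fact cobound_is_linear : linear cobound.
Proof.
move=> a phi psi; apply: cochain_ext => x z c.
rewrite /= !dprodDE !dprodZE /= /cobound_fun.
have hs : all3 (fun v1 v2 v3 => v3 = a *: v1 + v2)
    [seq phi x z c' | c' <- merges c] [seq psi x z c' | c' <- merges c]
    [seq (a *: phi + psi) x z c' | c' <- merges c].
  by apply: all3_diag.
rewrite (altsum_lin _ hs) !scalerDr.
rewrite [RHS]addrACA; congr (_ + _); first rewrite [RHS]addrACA; first congr (_ + _).
  by case: (chfirst c) => y [f d]; rewrite -lact_linr.
rewrite scalerA [a * _]mulrC -scalerA -scalerDr; congr (_ *: _).
by case: (chlast c) => w [d f]; rewrite -ract_linl.
Qed.
HB.instance Definition _ := GRing.isLinear.Build k (cochain M n)
  (cochain M n.+1) *:%R cobound cobound_is_linear.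
End Coboundary.

Lemma nth_map0 (V W : lmodType k) (f : {linear V -> W}) (s : seq V) i :
  [seq f v | v <- s]`_i = f s`_i.
Proof. by elim: s i => [|v s IH] [|i] //=; rewrite linear0. Qed.

Section CochainFunctor.
Variable n : nat.

Section Map.
Variables (M N : bimod C) (t : bimodmor M N).
Fact cochain_map_proof (phi : cochain M n) :
  (fun x z c => t z x (phi x z c)) \in @cochain_pred N n.
Proof.
by apply/asboolP => a x z c1 c2 c3 h; rewrite (cochainP phi h) linearP.
Qed.
Definition cochain_map phi : cochain N n := Cochain (cochain_map_proof phi).
Fact cochain_map_is_linear : linear cochain_map.
Proof. by move=> a phi psi; apply: cochain_ext => x z c; apply: (linearP (t z x)). Qed.
HB.instance Definition _ := GRing.isLinear.Build k (cochain M n) (cochain N n)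
  *:%R cochain_map cochain_map_is_linear.
End Map.

Definition cochain_fmap M N (t : mor (bimodcat C) M N) :
  {linear cochain M n -> cochain N n} := cochain_map t.
Fact cochain_fmap_is_linear M N : linear (@cochain_fmap M N).
Proof. by move=> a s t; apply: linear_ext => phi; apply: cochain_ext. Qed.
HB.instance Definition _ M N := GRing.isLinear.Build k (mor (bimodcat C) M N)
  {linear cochain M n -> cochain N n} *:%R
  (@cochain_fmap M N) (@cochain_fmap_is_linear M N).

Program Definition cochainF : linfunctor (bimodcat C) vectcat :=
  @LinFunctor k (bimod C) (lmodType k) (bimodcat C) vectcat
    (fun M => cochain M n) cochain_fmap _ _.
Next Obligation. by move=> M; apply: linear_ext => phi; apply: cochain_ext. Qed.
Next Obligation.
by move=> M N P t s; apply: linear_ext => phi; apply: cochain_ext.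
Qed.
End CochainFunctor.

Fact cobound_natural n :
  @natural _ _ (bimodcat C) vectcat (cochainF n) (cochainF n.+1)
    (fun M => @cobound M n).
Proof.
move=> M N t; apply: linear_ext => phi; apply: cochain_ext => x z c /=.
have [lt rt] := bimodmorP t.
rewrite /cobound_fun !linearD linear_sum linearZ; congr (_ + _ + _).
- by case: (chfirst c) => y [f d]; rewrite lt.
- apply: eq_bigr => i _; rewrite linearZ; congr (_ *: _).
  by rewrite -nth_map0 -map_comp.
- by congr (_ *: _); case: (chlast c) => w [d f]; rewrite rt.
Qed.

Fact zero_natural (F : linfunctor (bimodcat C) vectcat) :
  @natural _ _ (bimodcat C) vectcat F F (fun M => \0).
Proof. by move=> M N t; apply: linear_ext => v /=; rewrite linear0. Qed.

(* In degree 0 the incoming differential is zero. *)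
Definition HHco (n : nat) : linfunctor (bimodcat C) vectcat :=
  match n with
  | 0 => homologyF (zero_natural (cochainF 0)) (@cobound_natural 0)
  | m.+1 => homologyF (@cobound_natural m) (@cobound_natural m.+1)
  end.

Section Chains.
Variables (M : bimod C) (n : nat).

(* m (x) c_n (x) ... (x) c_1, with m in {}_{x_1}M_{x_{n+1}} *)
Record cword := CWord {
  csrc : ob;
  ctgt : ob;
  celt : bm M csrc ctgt;
  cchain : chain csrc n ctgt
}.
HB.instance Definition _ := gen_eqMixin cword.
HB.instance Definition _ := gen_choiceMixin cword.

Inductive cword_rel : {malg k[cword]} -> Prop :=
| cword_rel_elt a x z (m1 m2 : bm M x z) (c : chain x n z) :
    cword_rel (<< CWord (a *: m1 + m2) c >>
               - (a *: << CWord m1 c >> + << CWord m2 c >>))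
| cword_rel_chain a x z (m : bm M x z) (c1 c2 c3 : chain x n z) :
    chlin a c1 c2 c3 ->
    cword_rel (<< CWord m c3 >> - (a *: << CWord m c1 >> + << CWord m c2 >>)).

(* The direct sum over (x_{n+1}, ..., x_1) of the tensor products, as the free
   vector space on all words modulo linearity in each slot. *)
Definition hchains : lmodType k := quotl (lspan cword_rel).

Definition pure (w : cword) : hchains := qclass _ << w >>.

Lemma pure_lin_elt a x z (m1 m2 : bm M x z) (c : chain x n z) :
  pure (CWord (a *: m1 + m2) c) = a *: pure (CWord m1 c) + pure (CWord m2 c).
Proof.
rewrite /pure -[RHS](linearP (@qclass k _ _)); apply/qclass_eqP.
by apply: lspan_rel; apply: cword_rel_elt.
Qed.
Lemma pure_lin_chain a x z (m : bm M x z) (c1 c2 c3 : chain x n z) :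
  chlin a c1 c2 c3 ->
  pure (CWord m c3) = a *: pure (CWord m c1) + pure (CWord m c2).
Proof.
move=> h; rewrite /pure -[RHS](linearP (@qclass k _ _)); apply/qclass_eqP.
by apply: lspan_rel; apply: cword_rel_chain.
Qed.

Section Lift.
Variables (V : lmodType k) (f : cword -> V).
Hypothesis f_elt : forall a x z (m1 m2 : bm M x z) (c : chain x n z),
  f (CWord (a *: m1 + m2) c) = a *: f (CWord m1 c) + f (CWord m2 c).
Hypothesis f_chain : forall a x z (m : bm M x z) (c1 c2 c3 : chain x n z),
  chlin a c1 c2 c3 -> f (CWord m c3) = a *: f (CWord m c1) + f (CWord m c2).

Definition hlift_fun (q : hchains) : V := free_map f (qrepr q).

Lemma hlift_rel v : v \in lspan cword_rel -> free_map f v = 0.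
Proof.
have -> : (free_map f v = 0) <-> (v \in ker_pred (free_map f)).
  by split=> [h|/eqP]; [apply/eqP|].
move: v; apply: (lspan_map (f := idfun)) => v [a x z m1 m2 c|a x z m c1 c2 c3 h].
  by apply/eqP; rewrite linearB linearP !free_mapU f_elt subrr.
by apply/eqP; rewrite linearB linearP !free_mapU (f_chain _ h) subrr.
Qed.

Lemma hlift_funE v : hlift_fun (qclass _ v) = free_map f v.
Proof.
apply/eqP; rewrite -subr_eq0 -linearB; apply/eqP; apply: hlift_rel.
by apply/qclass_eqP; rewrite qreprK.
Qed.

Fact hlift_is_linear : linear hlift_fun.
Proof.
move=> a q r; rewrite -[q]qreprK -[r]qreprK.
move: (qrepr q) (qrepr r) => u v.
rewrite -[X in hlift_fun X](linearP (@qclass k _ _)).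
by rewrite !hlift_funE linearP.
Qed.
HB.instance Definition _ :=
  GRing.isLinear.Build k hchains V *:%R hlift_fun hlift_is_linear.
Definition hlift : {linear hchains -> V} := hlift_fun.

Lemma hliftE w : hlift (pure w) = f w.
Proof. by rewrite [LHS]hlift_funE free_mapU. Qed.
End Lift.

Lemma hchains_ext (V : lmodType k) (f g : {linear hchains -> V}) :
  (forall w, f (pure w) = g (pure w)) -> f = g.
Proof.
move=> fg; apply: linear_ext => q; rewrite -[q]qreprK.
exact: (free_ext (f := f \o @qclass k _ _) (g := g \o @qclass k _ _)).
Qed.
End Chains.

Section Boundary.
Variables (M : bimod C) (n : nat).

(* d (m (x) c_{n+1} (x) ... (x) c_1) = m c_{n+1} (x) c_n (x) ... (x) c_1
     + sum_{i=1}^n (-1)^i m (x) ... (x) c_{n+2-i} c_{n+1-i} (x) ...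
     + (-1)^{n+1} c_1 m (x) c_{n+1} (x) ... (x) c_2 *)
Definition hbound_word (w : cword M n.+1) : hchains M n :=
  let: CWord x z m c := w in
  (let: existT y (f, c') := chfirst c in pure (CWord (ract M m f) c'))
  + \sum_(i < n) (-1) ^+ i.+1 *: [seq pure (CWord m c') | c' <- merges c]`_i
  + (-1) ^+ n.+1 *:
      (let: existT u (c', g) := chlast c in pure (CWord (lact M g m) c')).

Fact hbound_elt a x z (m1 m2 : bm M x z) (c : chain x n.+1 z) :
  hbound_word (CWord (a *: m1 + m2) c) =
  a *: hbound_word (CWord m1 c) + hbound_word (CWord m2 c).
Proof.
rewrite /hbound_word.
have hs : all3 (fun v1 v2 v3 => v3 = a *: v1 + v2)
    [seq pure (CWord m1 c') | c' <- merges c]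
    [seq pure (CWord m2 c') | c' <- merges c]
    [seq pure (CWord (a *: m1 + m2) c') | c' <- merges c].
  by apply: all3_diag => d; apply: pure_lin_elt.
rewrite (altsum_lin _ hs) !scalerDr.
rewrite [RHS]addrACA; congr (_ + _); first rewrite [RHS]addrACA; first congr (_ + _).
  by case: (chfirst c) => y [f d]; rewrite ract_linl pure_lin_elt.
rewrite scalerA [a * _]mulrC -scalerA -scalerDr; congr (_ *: _).
by case: (chlast c) => w [d f]; rewrite lact_linr pure_lin_elt.
Qed.

Fact hbound_chain a x z (m : bm M x z) (c1 c2 c3 : chain x n.+1 z) :
  chlin a c1 c2 c3 ->
  hbound_word (CWord m c3) = a *: hbound_word (CWord m c1) + hbound_word (CWord m c2).
Proof.
move=> h; rewrite /hbound_word.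
have hs : all3 (fun v1 v2 v3 => v3 = a *: v1 + v2)
    [seq pure (CWord m c') | c' <- merges c1]
    [seq pure (CWord m c') | c' <- merges c2]
    [seq pure (CWord m c') | c' <- merges c3].
  by apply: (all3_map _ (merges_chlin h)) => d1 d2 d3; apply: pure_lin_chain.
rewrite (altsum_lin _ hs) !scalerDr.
rewrite [RHS]addrACA; congr (_ + _); first rewrite [RHS]addrACA; first congr (_ + _).
  case: (chfirst_chlin h) => [y f g c|y f d1 d2 d3 hd].
    by rewrite ract_linr pure_lin_elt.
  exact: pure_lin_chain.
rewrite scalerA [a * _]mulrC -scalerA -scalerDr; congr (_ *: _).
case: (chlast_chlin h) => [w c f g|w d1 d2 d3 f hd].
  by rewrite lact_linl pure_lin_elt.
exact: pure_lin_chain.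
Qed.

Definition hbound : {linear hchains M n.+1 -> hchains M n} :=
  hlift hbound_elt hbound_chain.
End Boundary.

Section ChainFunctor.
Variable n : nat.

Section Map.
Variables (M N : bimod C) (t : bimodmor M N).
Definition hchain_map_word (w : cword M n) : hchains N n :=
  let: CWord x z m c := w in pure (CWord (t x z m) c).
Fact hchain_map_elt a x z (m1 m2 : bm M x z) (c : chain x n z) :
  hchain_map_word (CWord (a *: m1 + m2) c) =
  a *: hchain_map_word (CWord m1 c) + hchain_map_word (CWord m2 c).
Proof. by rewrite /= linearP pure_lin_elt. Qed.
Fact hchain_map_chain a x z (m : bm M x z) (c1 c2 c3 : chain x n z) :
  chlin a c1 c2 c3 ->
  hchain_map_word (CWord m c3) =
  a *: hchain_map_word (CWord m c1) + hchain_map_word (CWord m c2).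
Proof. exact: pure_lin_chain. Qed.
Definition hchain_map : {linear hchains M n -> hchains N n} :=
  hlift hchain_map_elt hchain_map_chain.
End Map.

Definition hchain_fmap M N (t : mor (bimodcat C) M N) :
  {linear hchains M n -> hchains N n} := hchain_map t.
Fact hchain_fmap_is_linear M N : linear (@hchain_fmap M N).
Proof.
move=> a s t; apply: hchains_ext => -[x z m c].
by rewrite linearDE linearZE !hliftE /= -pure_lin_elt.
Qed.
HB.instance Definition _ M N := GRing.isLinear.Build k (mor (bimodcat C) M N)
  {linear hchains M n -> hchains N n} *:%R
  (@hchain_fmap M N) (@hchain_fmap_is_linear M N).

Program Definition hchainF : linfunctor (bimodcat C) vectcat :=
  @LinFunctor k (bimod C) (lmodType k) (bimodcat C) vectcat
    (fun M => hchains M n) hchain_fmap _ _.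
Next Obligation. by move=> M; apply: hchains_ext => -[x z m c]; rewrite hliftE. Qed.
Next Obligation.
move=> M N P t s; apply: hchains_ext => -[x z m c].
transitivity (hchain_fmap t (hchain_fmap s (pure (CWord m c)))) => //.
by rewrite !hliftE.
Qed.
End ChainFunctor.

Fact hbound_natural n :
  @natural _ _ (bimodcat C) vectcat (hchainF n.+1) (hchainF n)
    (fun M => @hbound M n).
Proof.
move=> M N t; apply: hchains_ext => -[x z m c].
transitivity (hchain_map n t (hbound M n (pure (CWord m c)))) => //.
transitivity (hbound N n (hchain_map n.+1 t (pure (CWord m c)))) => //.
have [lt rt] := bimodmorP t.
have tE (y w : ob) (q : bm M y w) (d : chain y n w) :
    hchain_map n t (pure (CWord q d)) = pure (CWord (t y w q) d) by rewrite hliftE.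
rewrite !hliftE /hbound_word.
rewrite !linearD linear_sum linearZ; congr (_ + _ + _).
- by case: (chfirst c) => y [f d]; rewrite tE rt.
- apply: eq_bigr => i _; rewrite linearZ; congr (_ *: _).
  rewrite -nth_map0 -map_comp; congr (_`_i); apply: eq_map => d.
  exact: tE.
- by congr (_ *: _); case: (chlast c) => w [d f]; rewrite tE lt.
Qed.

(* In degree 0 the outgoing differential is zero. *)
Definition HHho (n : nat) : linfunctor (bimodcat C) vectcat :=
  match n with
  | 0 => homologyF (@hbound_natural 0) (zero_natural (hchainF 0))
  | m.+1 => homologyF (@hbound_natural m.+1) (@hbound_natural m)
  end.

End Hochschild.
End Functors.

Arguments lact {k ob C} M {x y z} f m : rename.
Arguments ract {k ob C} M {x y w} m g : rename.
Arguments nt_fun {k obA obB A B F G} t x : rename.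
Arguments bmor {k ob C M N} t y x : rename.
Arguments cofun {k ob C M n} phi x z c : rename.

(* Main.v *)
(* Let F be an equivalence from C-modules to D-modules.  The full subcategory E of
   (D-modules)^op on the modules F(C(x, -)) and D(y, -) contains both C and D as full
   subcategories, and each of these generates E: every identity of E is a finite sum
   of morphisms u v factoring through the subcategory, because an equivalence
   preserves small projective objects.  So it suffices to treat the inclusion
   J : C -> E of a generating full subcategory.  Restriction of bimodules along J is
   an equivalence, with coinduction as inverse.  Restriction of cochains is a
   quasi-isomorphism for all coefficients M: in degree 0 by inspection, and in degree
   n + 1 by dimension shifting along 0 -> M -> Hom(E, M) -> Q -> 0, since Hom(E, M) is
   acyclic in positive degrees over E and, after restriction, over C.  Homology follows
   by duality: the cochains with coefficients in Hom(M, V) are the linear maps from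
   the chains with coefficients in M to V, and a chain map which induces a
   quasi-isomorphism on Hom(-, V) for all V is one itself. *)
Require Import Defs.
From mathcomp Require Import all_boot all_algebra.
From HB Require Import structures.
From mathcomp Require Import boolp.

Set Implicit Arguments.
Unset Strict Implicit.
Unset Printing Implicit Defensive.

Import GRing.Theory.
Local Open Scope ring_scope.
#[local] Obligation Tactic := idtac.

(** * Linear maps and linear categories *)

(** The sequence 0 -> M -> Hom(E, M) -> Q -> 0 need not split as bimodules, but evaluation at
    identities splits it over k in every entry; a cochain being a function on chains, the sequence
    stays exact on cochains, also after restriction. The delicate point is acyclicity over C: the
    restriction of Hom(E, M) is in general not Hom(C, -) of the restriction of M, so a bimodule
    retraction has to be written down from the finite decompositions of the identities. The opposite
    category is forced by Yoneda: morphisms from C(x, -) to C(y, -) are the elements of C(y, x). The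
    decompositions are finite because elements of a linear span are finite combinations. The duality
    argument quantifies over all vector spaces V so that cokernels built from the complexes can
    serve as test spaces. *)

Section LinearFunctions.
Variables (k : fieldType) (U V : lmodType k).

Definition mklinear (f : U -> V) (lf : linear f) : {linear U -> V} :=
  HB.pack f (GRing.isLinear.Build k U V *:%R f lf).

Lemma linf_sum (f : U -> V) (lf : linear f) (I : Type) (s : seq I) (F : I -> U) :
  f (\sum_(i <- s) F i) = \sum_(i <- s) f (F i).
Proof. exact: (linear_sum (mklinear lf)). Qed.
Lemma linfB (f : U -> V) (lf : linear f) u v : f (u - v) = f u - f v.
Proof. exact: (linearB (mklinear lf)). Qed.
Lemma linfZ (f : U -> V) (lf : linear f) a u : f (a *: u) = a *: f u.
Proof. by rewrite -[a *: u]addr0 lf (linear_fun0 lf) addr0. Qed.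
End LinearFunctions.

Lemma linear_bij (k : fieldType) (U V : lmodType k) (f : {linear U -> V}) :
  injective f -> (forall v, exists u, f u = v) ->
  exists g : {linear V -> U}, cancel f g /\ cancel g f.
Proof.
move=> fi fs; have [g gK] := choice fs.
have lg : linear g by move=> a u v; apply: fi; rewrite linearP !gK.
by exists (mklinear lg); split=> // u; apply: fi; apply: gK.
Qed.

Lemma linear_sum_fun (k : fieldType) (U V : lmodType k) (I : Type) (s : seq I)
    (F : I -> U -> V) :
  (forall i, linear (F i)) -> linear (fun u => \sum_(i <- s) F i u).
Proof.
move=> lF a u v; rewrite scaler_sumr -big_split; apply: eq_bigr => i _.
exact: lF.
Qed.

Section Categories.
Variable k : fieldType.

Section Isos.
Variables (ob : Type) (A : lincat k ob).

Lemma isomorphic_trans x y z :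
  isomorphic A x y -> isomorphic A y z -> isomorphic A x z.
Proof.
move=> [f [f' [f'f ff']]] [g [g' [g'g gg']]].
exists (mcomp A g f), (mcomp A f' g'); split.
  by rewrite -mcompA (mcompA g') g'g mcomp1m.
by rewrite -mcompA (mcompA f) ff' mcomp1m.
Qed.

Lemma isomorphic_sym x y : isomorphic A x y -> isomorphic A y x.
Proof. by move=> [f [g [gf fg]]]; exists g, f. Qed.
End Isos.

Lemma vectcat_iso (U V : lmodType k) (f : {linear U -> V}) :
  injective f -> (forall v, exists u, f u = v) -> @is_iso k _ (vectcat k) U V f.
Proof.
move=> fi fs; have [g [fK gK]] := linear_bij fi fs.
by exists g; split; apply: linear_ext.
Qed.

Lemma mcomp_suml (ob : Type) (A : lincat k ob) x y z (f : mor A x y) (I : Type)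
    (s : seq I) (F : I -> mor A y z) :
  mcomp A (\sum_(i <- s) F i) f = \sum_(i <- s) mcomp A (F i) f.
Proof. exact: (linf_sum (mcomp_linl f)). Qed.
Lemma mcomp_sumr (ob : Type) (A : lincat k ob) x y z (f : mor A y z) (I : Type)
    (s : seq I) (F : I -> mor A x y) :
  mcomp A f (\sum_(i <- s) F i) = \sum_(i <- s) mcomp A f (F i).
Proof. exact: (linf_sum (mcomp_linr f)). Qed.

Section Functors.
Variables (obA obB : Type) (A : lincat k obA) (B : lincat k obB).

Lemma fmap_iso (F : linfunctor A B) x y (f : mor A x y) :
  is_iso f -> is_iso (fmap F f).
Proof.
move=> [g [gf fg]]; exists (fmap F g).
by rewrite -!fmap_comp gf fg !fmap1.
Qed.

Lemma fmap_isomorphic (F : linfunctor A B) x y :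
  isomorphic A x y -> isomorphic B (F x) (F y).
Proof. by move=> [f hf]; exists (fmap F f); apply: fmap_iso. Qed.

Lemma nat_iso_obj (F G : linfunctor A B) x :
  nat_isomorphic F G -> isomorphic B (F x) (G x).
Proof. by move=> [t [_ ht]]; exists (t x). Qed.

Lemma nat_iso_sym (F G : linfunctor A B) : nat_isomorphic F G -> nat_isomorphic G F.
Proof.
move=> [t [nt it]].
have [s hs] : exists s : forall x, mor B (G x) (F x), forall x,
    mcomp B (s x) (t x) = idm B (F x) /\ mcomp B (t x) (s x) = idm B (G x).
  exists (fun x => projT1 (cid (it x))) => x; exact: (projT2 (cid (it x))).
exists s; split=> [x y f|x]; last by exists (t x); case: (hs x).
have [_ tsx] := hs x; have [sty _] := hs y.
rewrite -[RHS]mcompm1 -tsx mcompA -(mcompA (s y)) nt mcompA sty.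
by rewrite mcomp1m.
Qed.

Lemma nat_iso_trans (F G H : linfunctor A B) :
  nat_isomorphic F G -> nat_isomorphic G H -> nat_isomorphic F H.
Proof.
move=> [t [nt it]] [s [ns is_]]; exists (fun x => mcomp B (s x) (t x)); split.
  by move=> x y f; rewrite mcompA ns -mcompA nt mcompA.
move=> x; have [t' [t't tt']] := it x; have [s' [s's ss']] := is_ x.
exists (mcomp B t' s'); split.
  by rewrite -mcompA (mcompA s') s's mcomp1m.
by rewrite -mcompA (mcompA (t x)) tt' mcomp1m.
Qed.
End Functors.

Lemma nat_iso_whiskerr (obA obB obE : Type) (A : lincat k obA) (B : lincat k obB)
    (E : lincat k obE) (G H : linfunctor B E) (F : linfunctor A B) :
  nat_isomorphic G H -> nat_isomorphic (compfunctor G F) (compfunctor H F).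
Proof.
move=> [t [nt it]]; exists (fun x => t (F x)); split=> [x y f|x]; last exact: it.
exact: nt.
Qed.

Lemma nat_iso_whiskerl (obA obB obE : Type) (A : lincat k obA) (B : lincat k obB)
    (E : lincat k obE) (G : linfunctor B E) (F H : linfunctor A B) :
  nat_isomorphic F H -> nat_isomorphic (compfunctor G F) (compfunctor G H).
Proof.
move=> [t [nt it]]; exists (fun x => fmap G (t x)); split=> [x y f|x].
  by rewrite /= -!fmap_comp; congr (fmap G _); apply: nt.
exact: (fmap_iso G (it x)).
Qed.

Lemma compfunctorA (obA obB obE obH : Type) (A : lincat k obA) (B : lincat k obB)
    (E : lincat k obE) (L : lincat k obH)
    (H : linfunctor E L) (G : linfunctor B E) (F : linfunctor A B) :
  nat_isomorphic (compfunctor (compfunctor H G) F) (compfunctor H (compfunctor G F)).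
Proof.
exists (fun x => idm L (H (G (F x)))); split=> [x y f|x].
  by rewrite mcomp1m mcompm1.
by exists (idm L (H (G (F x)))); rewrite !mcomp1m.
Qed.

Lemma compfunctorm1 (obA obB : Type) (A : lincat k obA) (B : lincat k obB)
    (F : linfunctor A B) :
  nat_isomorphic (compfunctor F (idfunctor A)) F.
Proof.
exists (fun x => idm B (F x)); split=> [x y f|x].
  by rewrite mcomp1m mcompm1.
by exists (idm B (F x)); rewrite !mcomp1m.
Qed.

Lemma equivalence_comp (obA obB obE : Type) (A : lincat k obA) (B : lincat k obB)
    (E : lincat k obE) (G : linfunctor B E) (F : linfunctor A B) :
  is_equivalence G -> is_equivalence F -> is_equivalence (compfunctor G F).
Proof.
(* The two natural isomorphisms required are instances of one statement, with the functors and their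
   quasi-inverses exchanged. *)
suff red (obA' obB' obE' : Type) (A' : lincat k obA') (B' : lincat k obB')
    (E' : lincat k obE') (P : linfunctor B' E') (Q : linfunctor A' B')
    (P' : linfunctor E' B') (Q' : linfunctor B' A') :
    nat_isomorphic (compfunctor P' P) (idfunctor B') ->
    nat_isomorphic (compfunctor Q' Q) (idfunctor A') ->
    nat_isomorphic (compfunctor (compfunctor Q' P') (compfunctor P Q)) (idfunctor A').
  move=> [G1 [G1G GG1]] [F1 [F1F FF1]]; exists (compfunctor F1 G1).
  by split; apply: red.
move=> hP hQ.
apply: nat_iso_trans (compfunctorA _ _ _) _.
apply: nat_iso_trans hQ.
apply: nat_iso_whiskerl.
apply: nat_iso_trans (nat_iso_sym (compfunctorA _ _ _)) _.
apply: nat_iso_trans (nat_iso_whiskerr _ hP) _.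
exists (fun x => idm B' (Q x)); split=> [x y f|x].
  by rewrite mcomp1m mcompm1.
by exists (idm B' (Q x)); rewrite !mcomp1m.
Qed.

End Categories.

Section Bimodules.
Variables (k : fieldType) (ob : Type) (C : lincat k ob).

Lemma bimodmor_lact (M N : bimod C) (t : bimodmor M N) x y z (f : mor C y z)
    (m : bm M y x) : t z x (lact M f m) = lact N f (t y x m).
Proof. exact: (bimodmorP t).1. Qed.
Lemma bimodmor_ract (M N : bimod C) (t : bimodmor M N) x y w (m : bm M y x)
    (g : mor C w x) : t y w (ract M m g) = ract N (t y x m) g.
Proof. exact: (bimodmorP t).2. Qed.

Definition mkbimodmor (M N : bimod C)
    (t : forall y x, {linear bm M y x -> bm N y x})
    (tl : forall x y z (f : mor C y z) (m : bm M y x),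
       t z x (lact M f m) = lact N f (t y x m))
    (tr : forall x y w (m : bm M y x) (g : mor C w x),
       t y w (ract M m g) = ract N (t y x m) g) : bimodmor M N :=
  BimodMor (asboolT (conj tl tr) : (t : dprod _) \in @bimod_morphism_pred _ _ _ M N).

Lemma bimodmor_iso (M N : bimod C) (t : bimodmor M N) :
  (forall y x, injective (t y x)) -> (forall y x n, exists m, t y x m = n) ->
  @is_iso k _ (bimodcat C) M N t.
Proof.
move=> ti ts.
pose s y x := projT1 (cid (linear_bij (@ti y x) (@ts y x))).
have tK y x : cancel (t y x) (s y x) := (projT2 (cid (linear_bij (@ti y x) (@ts y x)))).1.
have sK y x : cancel (s y x) (t y x) := (projT2 (cid (linear_bij (@ti y x) (@ts y x)))).2.
have sl x y z (f : mor C y z) (m : bm N y x) : s z x (lact N f m) = lact M f (s y x m).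
  by apply: (@ti z x); rewrite bimodmor_lact !sK.
have sr x y w (m : bm N y x) (g : mor C w x) : s y w (ract N m g) = ract M (s y x m) g.
  by apply: (@ti y w); rewrite bimodmor_ract !sK.
exists (@mkbimodmor N M s sl sr); split; apply: bimodmor_ext => y x m; [exact: tK | exact: sK].
Qed.

End Bimodules.

(** * Dimension shifting for cochains *)

Section Cochains.
Variables (k : fieldType) (ob : Type) (C : lincat k ob).
Implicit Types M N : bimod C.

(** Inversion of a nonempty chain; the predicate [P], defined by cases on the length, keeps the
    dependent elimination well typed. *)
Lemma chainSP x n z (c : chain C x n.+1 z) :
  exists y (g : mor C y z) (d : chain C x n y), c = chainS g d.
Proof.
pose P m z := match m return chain C x m z -> Prop with
  | 0 => fun _ => True
  | m'.+1 => fun c => exists y (g : mor C y z) (d : chain C x m' y), c = chainS g d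
  end.
suff : P n.+1 z c by [].
by case: c => // m y t g d; exists y, g, d.
Qed.

Lemma cobound_map M N (t : bimodmor M N) n (phi : cochain M n) :
  cobound (cochain_map t phi) = cochain_map t (cobound phi).
Proof.
exact: (esym (congr1 (fun h : {linear cochain M n -> cochain N n.+1} => h phi)
  (@cobound_natural _ _ C n M N t))).
Qed.

Section Post.
Variables (M N : bimod C) (t : forall z x, {linear bm M z x -> bm N z x}) (n : nat).
Fact cochain_post_proof (phi : cochain M n) :
  ((fun x z c => t z x (phi x z c)) : dprod _) \in @cochain_pred _ _ _ N n.
Proof. by apply/asboolP => a x z c1 c2 c3 h; rewrite (cochainP phi h) linearP. Qed.
(** The maps [t z x] need not commute with the actions, so this need not commute with [cobound]; it
    serves to lift cochains along sections that are only k-linear. *)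
Definition cochain_post phi : cochain N n := Cochain (cochain_post_proof phi).
End Post.

Lemma cochain_map_surj M N (t : bimodmor M N)
    (s : forall z x, {linear bm N z x -> bm M z x}) n (phi : cochain N n) :
  (forall z x, cancel (s z x) (t z x)) -> exists psi, cochain_map t psi = phi.
Proof.
by move=> sK; exists (cochain_post s phi); apply: cochain_ext => x z c; apply: sK.
Qed.

Lemma cochain_map_inj M N (t : bimodmor M N) n :
  (forall z x, injective (t z x)) -> injective (@cochain_map _ _ _ n _ _ t).
Proof.
move=> ti phi psi e; apply: cochain_ext => x z c; apply: ti.
exact: (congr1 (fun chi : cochain N n => chi x z c) e).
Qed.

Lemma cochain_map_exact M N P (t : bimodmor M N) (s : bimodmor N P)
    (r : forall z x, {linear bm N z x -> bm M z x}) n (phi : cochain N n) :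
  (forall z x q, s z x q = 0 -> t z x (r z x q) = q) ->
  cochain_map s phi = 0 -> exists psi, cochain_map t psi = phi.
Proof.
move=> tr e; exists (cochain_post r phi); apply: cochain_ext => x z c.
by apply: tr; apply: (congr1 (fun chi : cochain P n => chi x z c) e).
Qed.

(** * The bimodule Hom(C, M) and currying of cochains *)

Section Iterated.
Variable M : bimod C.

(** This is Hom(C, M): the left action is by precomposition, the right action is that of [M] on
    values. It is the coinduction of [M] with its left action forgotten. *)
Definition hombm e x : lmodType k := dprod (fun z => {linear mor C e z -> bm M z x}).

Lemma hombm_ext e x (p q : hombm e x) : (forall z g, p z g = q z g) -> p = q.
Proof.
by move=> pq; apply: functional_extensionality_dep => z; apply: linear_ext => g.
Qed.

Definition hom_lact x y z (f : mor C y z) (p : hombm y x) : hombm z x :=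
  fun e => p e \o mklinear (mcomp_linl (z := e) f).
Definition hom_ract x y w (p : hombm y x) (g : mor C w x) : hombm y w :=
  fun e => mklinear (ract_linl (b := M) (y := e) g) \o p e.

Program Definition homb : bimod C := @Bimod k ob C hombm hom_lact hom_ract
  _ _ _ _ _ _ _ _ _.
Next Obligation.
move=> x y z m a f g; apply: hombm_ext => e h /=.
by rewrite mcomp_linr linearP.
Qed.
Next Obligation. by move=> x y z m a f g; apply: hombm_ext. Qed.
Next Obligation.
move=> x y w m a f g; apply: hombm_ext => e h /=; exact: ract_linl.
Qed.
Next Obligation.
move=> x y w m a f g; apply: hombm_ext => e h /=; exact: ract_linr.
Qed.
Next Obligation. by move=> x y p; apply: hombm_ext => e h /=; rewrite mcompm1. Qed.
Next Obligation. by move=> x y z t g f p; apply: hombm_ext => e h /=; rewrite mcompA. Qed.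
Next Obligation. by move=> x y p; apply: hombm_ext => e h /=; rewrite ract1. Qed.
Next Obligation. by move=> x y w v m f g; apply: hombm_ext => e h /=; rewrite ractA. Qed.
Next Obligation. by move=> x y w v m f g; apply: hombm_ext => e h. Qed.

Lemma homb_ext e x (p q : bm homb e x) :
  (forall z g, (p : hombm e x) z g = (q : hombm e x) z g) -> p = q.
Proof. exact: hombm_ext. Qed.

Definition hom_unit_fun e x (m : bm M e x) : hombm e x :=
  fun z => mklinear (lact_linl (z := z) m).
Fact hom_unit_linear e x : linear (@hom_unit_fun e x).
Proof. by move=> a m m'; apply: hombm_ext => z g /=; apply: lact_linr. Qed.
Fact hom_unit_lact x y z (f : mor C y z) (m : bm M y x) :
  mklinear (@hom_unit_linear z x) (lact M f m)
  = lact homb f (mklinear (@hom_unit_linear y x) m).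
Proof. by apply: hombm_ext => e g /=; rewrite lactA. Qed.
Fact hom_unit_ract x y w (m : bm M y x) (g : mor C w x) :
  mklinear (@hom_unit_linear y w) (ract M m g)
  = ract homb (mklinear (@hom_unit_linear y x) m) g.
Proof. by apply: hombm_ext => e h /=; rewrite lractA. Qed.
Definition hom_unit : bimodmor M homb :=
  @mkbimodmor _ _ _ M homb (fun e x => mklinear (@hom_unit_linear e x))
    hom_unit_lact hom_unit_ract.

(** This retraction of [hom_unit] respects the right action but in general not the left one, since
    evaluating f p gives p f and not f (p 1). Hence it is kept as a family of linear maps. *)
Definition hom_ev_fun e x (p : hombm e x) : bm M e x := p e (idm C e).
Fact hom_ev_linear e x : linear (@hom_ev_fun e x).
Proof. by []. Qed.
Definition hom_ev e x : {linear bm homb e x -> bm M e x} := mklinear (@hom_ev_linear e x).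

Lemma hom_unitK e x : cancel (hom_unit e x) (hom_ev e x).
Proof. by move=> m /=; apply: lact1. Qed.

Section Curry.
Variables (n : nat) (phi : cochain M n.+1).
(** Currying in the leftmost slot trades one degree for a change of coefficients from [M] to
    [homb M]. *)
Definition curry_fun x y (c : chain C x n y) : hombm y x := fun z =>
  mklinear (fun a g h => cochainP phi (chlin_head a g h c)).
Fact curry_proof : (curry_fun : dprod _) \in @cochain_pred _ _ _ homb n.
Proof.
apply/asboolP => a x z c1 c2 c3 h; apply: hombm_ext => e g /=.
by apply: (cochainP phi); apply: chlin_tail.
Qed.
Definition curry : cochain homb n := Cochain curry_proof.
End Curry.

Lemma curryE n (phi : cochain M n.+1) x y (c : chain C x n y) z (g : mor C y z) :
  curry phi x y c z g = phi x z (chainS g c).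
Proof. by []. Qed.

Lemma curry_inj n : injective (@curry n).
Proof.
move=> phi psi e; apply: cochain_ext => x z c.
by have [y [g [d ->]]] := chainSP c; rewrite -!curryE e.
Qed.

Lemma curry_linear n : linear (@curry n).
Proof. by move=> a phi psi; apply: cochain_ext => x z c; apply: hombm_ext. Qed.

(* The first two terms of the differential of [phi] at [(g, c)] are [g] acting on
   [phi c] and the value at [g] of the first term of the differential of
   [curry phi] at [c]; the remaining terms match with opposite signs. *)
Lemma curry_cobound n (phi : cochain M n.+1) :
  curry (cobound phi) = cochain_map hom_unit phi - cobound (curry phi).
Proof.
apply: cochain_ext => x z c; apply: hombm_ext => e g.
have [y [h [d dc]]] := chainSP c.
have mE : merges (chainS g c) = chainS (mcomp C g h) d :: [seq chainS g c' | c' <- merges c].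
  by rewrite dc.
transitivity (cobound_fun phi (chainS g c)) => //.
have evl : linear (fun q : hombm z x => q e g) by [].
have [ev evE] : exists ev : {linear bm homb z x -> bm M e x}, forall q, ev q = q e g.
  by exists (mklinear evl).
transitivity (lact M g (phi x z c) - ev (cobound_fun (curry phi) c)); last by rewrite evE.
rewrite /cobound_fun mE chlastS [chfirst (chainS g c)]/=.
rewrite -addrA; congr (_ + _); rewrite big_ord_recl /= expr1 scaleN1r -addrA.
rewrite !(linearD ev) (linear_sum ev) (linearZ_LR ev) !opprD -addrA; congr (_ + _).
  by rewrite evE dc.
rewrite -sumrN; congr (_ + _).
  apply: eq_bigr => i _; rewrite exprS -scalerA scaleN1r (linearZ_LR ev) add0n
    /bump leq0n add1n; congr (- (_ *: _)).
  rewrite -nth_map0 -!map_comp; congr (_`_i); apply: eq_map => c'; exact/esym/evE.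
rewrite exprS -scalerA scaleN1r; congr (- (_ *: _)).
by case: (chlast c) => w [c' g0]; rewrite evE.
Qed.

End Iterated.

Lemma chain0_ind x (P : forall z, chain C x 0 z -> Prop) :
  P x (chain0 C x) -> forall z c, P z c.
Proof.
move=> P0 z c.
pose R m z := match m return chain C x m z -> Prop with
  | 0 => fun c => P z c
  | _ => fun _ => True
  end.
suff : R 0%N z c by [].
by case: c.
Qed.

Lemma cobound0E M (phi : cochain M 0) x z (g : mor C x z) :
  cobound phi x z (chainS g (chain0 C x))
  = lact M g (phi x x (chain0 C x)) - ract M (phi z z (chain0 C z)) g.
Proof.
transitivity (cobound_fun phi (chainS g (chain0 C x))) => //.
by rewrite /cobound_fun big_ord0 /= addr0 expr1 scaleN1r.
Qed.

Lemma cobound1E M (phi : cochain M 1) x y z (f : mor C y z) (g : mor C x y) :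
  cobound phi x z (chainS f (chainS g (chain0 C x)))
  = lact M f (phi x y (chainS g (chain0 C x)))
    - phi x z (chainS (mcomp C f g) (chain0 C x))
    + ract M (phi y z (chainS f (chain0 C y))) g.
Proof.
transitivity (cobound_fun phi (chainS f (chainS g (chain0 C x)))) => //.
rewrite /cobound_fun big_ord_recl big_ord0 /=.
by rewrite addr0 expr1 scaleN1r sqrrN expr1n scale1r.
Qed.

(** Write u for [hom_unit M]. By [curry_cobound], d (d phi) curries to u (d phi) - d (u phi - d
    (curry phi)) = d (d (curry phi)), which has lower degree and coefficients in [homb M]; hence the
    induction over all [M]. Alternating sums are expanded only in degree 0. *)
Lemma coboundK M n (phi : cochain M n) : cobound (cobound phi) = 0.
Proof.
elim: n M phi => [|n IH] M phi.
  apply: cochain_ext => x z c.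
  have [y [f [d ->]]] := chainSP c; have [w [g [{}c ->]]] := chainSP d.
  move: w c g; apply: chain0_ind => g.
  rewrite cobound1E !cobound0E (linfB (lact_linr _)) (linfB (ract_linl _)).
  rewrite !lactA !ractA lractA.
  have cancelE (V : zmodType) (a b e : V) : a - b - (a - e) + (b - e) = 0.
    by rewrite opprB addrC (addrC (a - b)) !addrA !subrK subrr.
  exact: cancelE.
apply: (@curry_inj M n.+2); rewrite (linear_fun0 (@curry_linear M _)).
rewrite curry_cobound -cobound_map curry_cobound linearB /= IH subr0.
by rewrite subrr.
Qed.

(** For a cocycle [phi], [curry_cobound] says that d (curry phi) is the image of [phi] under
    [hom_unit]. A retraction [t] that is a morphism of bimodules, unlike [hom_ev], commutes with d
    and turns this into a primitive of [phi]. *)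
Lemma cocycle_retract M n (t : bimodmor (homb M) M) (phi : cochain M n.+1) :
  (forall e x, cancel (hom_unit M e x) (t e x)) ->
  cobound phi = 0 -> exists psi : cochain M n, cobound psi = phi.
Proof.
move=> tK dphi; exists (cochain_map t (curry phi)); rewrite cobound_map.
have := curry_cobound phi; rewrite dphi (linear_fun0 (@curry_linear M _)).
move/esym/eqP; rewrite subr_eq0 => /eqP <-.
by apply: cochain_ext => x z c; apply: tK.
Qed.

Section UnitCokernel.
Variable M : bimod C.

(* The cokernel of [hom_unit M], embedded in [homb M] as the kernel of the
   retraction [hom_ev] of [hom_unit M]. *)
Definition qhombm e x : lmodType k := cycles (hom_ev M e x).

Fact hom_proj_proof e x (p : bm (homb M) e x) :
  p - hom_unit M e x (hom_ev M e x p) \in ker_pred (hom_ev M e x).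
Proof. by apply/eqP; rewrite linearB hom_unitK subrr. Qed.
Definition hom_proj_fun e x p : qhombm e x := Cycle (hom_proj_proof p).
Fact hom_proj_linear e x : linear (@hom_proj_fun e x).
Proof.
move=> a p q; apply: val_inj => /=; rewrite scalerBr addrACA -opprD.
by congr (_ - _); apply: hom_unit_linear.
Qed.

Lemma hom_proj_unit e x m : hom_proj_fun (hom_unit M e x m) = 0.
Proof.
apply: val_inj; apply/eqP; rewrite subr_eq0; apply/eqP.
by congr (hom_unit_fun _); apply/esym/lact1.
Qed.
Lemma hom_projK e x (q : qhombm e x) : hom_proj_fun (cycle_val q) = q.
Proof.
apply: val_inj; case: q => q /= /eqP q0.
by rewrite [X in hom_unit_fun X]q0 (linear_fun0 (@hom_unit_linear M e x)) subr0.
Qed.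

Lemma hom_proj_ker e x (p : bm (homb M) e x) :
  hom_proj_fun p = 0 -> hom_unit M e x (hom_ev M e x p) = p.
Proof.
by move/(congr1 (@cycle_val _ _ _ _)) => /eqP; rewrite subr_eq0 => /eqP/esym.
Qed.

(** The kernel of [hom_ev] need not be stable under the left action, so the result is projected back
    along the image of [hom_unit]. *)
Definition qhom_lact x y z (f : mor C y z) (q : qhombm y x) : qhombm z x :=
  hom_proj_fun (lact (homb M) f (cycle_val q)).
Definition qhom_ract x y w (q : qhombm y x) (g : mor C w x) : qhombm y w :=
  hom_proj_fun (ract (homb M) (cycle_val q) g).

(** The projection alters [p] by an element of the image of [hom_unit]; the actions preserve this
    image and the projection kills it. The bimodule axioms of the cokernel follow from those of
    [homb M]. *)
Lemma qhom_lact_proj x y z (f : mor C y z) (p : bm (homb M) y x) :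
  qhom_lact f (hom_proj_fun p) = hom_proj_fun (lact (homb M) f p).
Proof.
rewrite /qhom_lact (linfB (lact_linr f)) -bimodmor_lact (linfB (@hom_proj_linear _ _)).
by rewrite hom_proj_unit subr0.
Qed.
Lemma qhom_ract_proj x y w (p : bm (homb M) y x) (g : mor C w x) :
  qhom_ract (hom_proj_fun p) g = hom_proj_fun (ract (homb M) p g).
Proof.
rewrite /qhom_ract (linfB (ract_linl g)) -bimodmor_ract (linfB (@hom_proj_linear _ _)).
by rewrite hom_proj_unit subr0.
Qed.

Program Definition qhomb : bimod C := @Bimod k ob C qhombm qhom_lact qhom_ract
  _ _ _ _ _ _ _ _ _.
Next Obligation.
by move=> x y z m a f g; rewrite /qhom_lact lact_linl hom_proj_linear.
Qed.
Next Obligation.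
by move=> x y z f a m m'; rewrite /qhom_lact -hom_proj_linear -lact_linr.
Qed.
Next Obligation.
by move=> x y w g a m m'; rewrite /qhom_ract -hom_proj_linear -ract_linl.
Qed.
Next Obligation.
by move=> x y w m a f g; rewrite /qhom_ract ract_linr hom_proj_linear.
Qed.
Next Obligation. by move=> x y m; rewrite /qhom_lact lact1 hom_projK. Qed.
Next Obligation.
by move=> x y z t g f m; rewrite [LHS]/qhom_lact lactA -!qhom_lact_proj hom_projK.
Qed.
Next Obligation. by move=> x y m; rewrite /qhom_ract ract1 hom_projK. Qed.
Next Obligation.
by move=> x y w v m f g; rewrite [LHS]/qhom_ract ractA -!qhom_ract_proj hom_projK.
Qed.
Next Obligation.
move=> x y z w f m g; rewrite -[m]hom_projK.
by rewrite !(qhom_lact_proj, qhom_ract_proj) lractA.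
Qed.

Definition hom_proj : bimodmor (homb M) qhomb :=
  @mkbimodmor _ _ _ (homb M) qhomb (fun e x => mklinear (@hom_proj_linear e x))
    (fun x y z f m => esym (qhom_lact_proj f m))
    (fun x y w m g => esym (qhom_ract_proj m g)).

Fact hom_sect_linear e x : linear (fun q : bm qhomb e x => cycle_val q : bm (homb M) e x).
Proof. by []. Qed.
Definition hom_sect e x : {linear bm qhomb e x -> bm (homb M) e x} :=
  mklinear (@hom_sect_linear e x).

End UnitCokernel.
End Cochains.

Section Cochains0.
Variables (k : fieldType) (ob : Type) (C : lincat k ob) (M : bimod C).

Fact cochain0_proof (m : forall e, bm M e e) :
  ((fun x z (c : chain C x 0 z) =>
      match c in chain _ _ n z return bm M z x with
      | chain0 => m x
      | chainS _ _ _ _ _ => 0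
      end) : dprod _) \in @cochain_pred _ _ _ M 0.
Proof. by apply/asboolP => a x z c1 c2 c3 h; inversion h. Qed.
Definition cochain0 m : cochain M 0 := Cochain (cochain0_proof m).

(** The incoming differential in degree 0 is zero, so there only 0 is a coboundary. With this
    convention the dimension shift treats degree 0 like the others. *)
Definition is_cobound n : cochain M n -> Prop :=
  match n with
  | 0 => fun phi => phi = 0
  | m.+1 => fun phi => exists psi, cobound psi = phi
  end.

Lemma is_cobound_cobound n (phi : cochain M n) : is_cobound phi -> cobound phi = 0.
Proof.
case: n phi => [|n] phi /= => [->|[psi <-]]; last exact: coboundK.
exact: (linear_fun0 (@cobound_is_linear _ _ _ M 0)).
Qed.

End Cochains0.

Section CoboundMap.
Variables (k : fieldType) (ob : Type) (C : lincat k ob) (M N : bimod C).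
Variables (t : bimodmor M N).

Lemma is_cobound_map n (phi : cochain M n) :
  is_cobound phi -> is_cobound (cochain_map t phi).
Proof.
case: n phi => [|n] phi /= => [->|[f <-]]; first exact: linear0.
by exists (cochain_map t f); rewrite cobound_map.
Qed.

Lemma is_cobound_lift n (phi : cochain N n) :
  (forall m (psi : cochain N m), exists psi', cochain_map t psi' = psi) ->
  is_cobound phi -> exists psi, is_cobound psi /\ cochain_map t psi = phi.
Proof.
move=> ts; case: n phi => [|n] phi /= => [->|[f <-]].
  by exists 0; split=> //; apply: linear0.
have [g <-] := ts n f; exists (cobound g); split; first by exists g.
by rewrite cobound_map.
Qed.
End CoboundMap.

(** On [homb M] the left action is precomposition, so evaluating the inner function at the identity,
    which sends p to g |-> (p g) 1, is a bimodule morphism from [homb (homb M)] to [homb M]. It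
    retracts [hom_unit], and [cocycle_retract] applies. *)
Lemma homb_cocycle (k : fieldType) (ob : Type) (C : lincat k ob) (M : bimod C) n
    (phi : cochain (homb M) n.+1) :
  cobound phi = 0 -> exists psi, cobound psi = phi.
Proof.
pose s e x (p : bm (homb (homb M)) e x) : bm (homb M) e x :=
  fun z => mklinear (fun a f g => congr1 (fun q : hombm M z x => q z (idm C z))
    (linearP (p z) a f g)).
have sl e x : linear (@s e x) by move=> a p q; apply: homb_ext.
have sL x y z (f : mor C y z) p : mklinear (@sl z x) (lact (homb (homb M)) f p)
    = lact (homb M) f (mklinear (@sl y x) p) by apply: homb_ext.
have sR x y w p (g : mor C w x) : mklinear (@sl y w) (ract (homb (homb M)) p g)
    = ract (homb M) (mklinear (@sl y x) p) g by apply: homb_ext.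
apply: (@cocycle_retract _ _ _ _ _ (@mkbimodmor _ _ _ (homb (homb M)) (homb M) _ sL sR)).
by move=> e x p; apply: homb_ext => z g /=; rewrite mcomp1m.
Qed.

(** * Restriction of cochains to a generating full subcategory *)

Section Restriction.
Variables (k : fieldType) (obC obE : Type) (C : lincat k obC) (E : lincat k obE).
Variable J : linfunctor C E.

Program Definition resb (M : bimod E) : bimod C :=
  @Bimod k obC C (fun y x => bm M (J y) (J x))
    (fun x y z f m => lact M (fmap J f) m) (fun x y w m g => ract M m (fmap J g))
    _ _ _ _ _ _ _ _ _.
Next Obligation. by move=> M x y z m a f g /=; rewrite linearP lact_linl. Qed.
Next Obligation. by move=> M x y z f a m m'; rewrite lact_linr. Qed.
Next Obligation. by move=> M x y w g a m m'; rewrite ract_linl. Qed.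
Next Obligation. by move=> M x y w m a f g /=; rewrite linearP ract_linr. Qed.
Next Obligation. by move=> M x y m /=; rewrite fmap1 lact1. Qed.
Next Obligation. by move=> M x y z t g f m /=; rewrite fmap_comp lactA. Qed.
Next Obligation. by move=> M x y m /=; rewrite fmap1 ract1. Qed.
Next Obligation. by move=> M x y w v m f g /=; rewrite fmap_comp ractA. Qed.
Next Obligation. by move=> M x y z w f m g /=; rewrite lractA. Qed.

Definition resb_mor M N (t : mor (bimodcat E) M N) : mor (bimodcat C) (resb M) (resb N) :=
  @mkbimodmor _ _ _ (resb M) (resb N) (fun y x => t (J y) (J x))
    (fun x y z f m => bimodmor_lact t (fmap J f) m)
    (fun x y w m g => bimodmor_ract t m (fmap J g)).
Fact resb_mor_linear M N : linear (@resb_mor M N).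
Proof. by move=> a s t; apply: bimodmor_ext. Qed.
Program Definition resF : linfunctor (bimodcat E) (bimodcat C) :=
  @LinFunctor k (bimod E) (bimod C) (bimodcat E) (bimodcat C) resb
    (fun M N => mklinear (@resb_mor_linear M N)) _ _.
Next Obligation. by move=> M; apply: bimodmor_ext. Qed.
Next Obligation. by move=> M N P g f; apply: bimodmor_ext. Qed.

Fixpoint chmap x n z (c : chain C x n z) : chain E (J x) n (J z) :=
  match c with
  | chain0 => chain0 E (J x)
  | chainS _ _ _ f d => chainS (fmap J f) (chmap d)
  end.

Lemma chlin_chmap a x n z (c1 c2 c3 : chain C x n z) :
  chlin a c1 c2 c3 -> chlin a (chmap c1) (chmap c2) (chmap c3).
Proof.
elim=> {n z c1 c2 c3} [n y z f g c|n y z f c1 c2 c3 h IH] /=.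
  by rewrite linearP; apply: chlin_head.
exact: chlin_tail.
Qed.

Lemma merges_chmap x n z (c : chain C x n z) :
  merges (chmap c) = [seq chmap d | d <- merges c].
Proof.
elim: c => //= {}n y {}z f c; case: c f => //= {}n w {}y g c f IH.
rewrite fmap_comp IH -!map_comp; congr (_ :: _).
Qed.

Lemma chfirst_chmap x n z (c : chain C x n.+1 z) :
  chfirst (chmap c) = let: existT y (f, d) := chfirst c in
    existT (fun y => (mor E y (J z) * chain E (J x) n y)%type) (J y) (fmap J f, chmap d).
Proof. by have [y [f [d ->]]] := chainSP c. Qed.

Lemma chlast_chmap x n z (c : chain C x n.+1 z) :
  chlast (chmap c) = let: existT w (d, g) := chlast c in
    existT (fun w => (chain E w n (J z) * mor E (J x) w)%type) (J w) (chmap d, fmap J g).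
Proof.
elim: n z c => [|n IH] z c; have [y [f [d ->]]] := chainSP c.
  by move: y d f; apply: chain0_ind.
rewrite [chmap _]/= !chlastS IH.
by case: (chlast d) => w [d' g].
Qed.

Section ResCochain.
Variables (M : bimod E) (n : nat).
Fact resco_proof (phi : cochain M n) :
  ((fun x z c => phi (J x) (J z) (chmap c)) : dprod _) \in @cochain_pred _ _ _ (resb M) n.
Proof.
by apply/asboolP => a x z c1 c2 c3 h; apply: (cochainP phi); apply: chlin_chmap.
Qed.
Definition resco_fun phi : cochain (resb M) n := Cochain (resco_proof phi).
Fact resco_linear : linear resco_fun.
Proof. by move=> a phi psi; apply: cochain_ext. Qed.
Definition resco : {linear cochain M n -> cochain (resb M) n} := mklinear resco_linear.
End ResCochain.

Lemma resco_cobound M n (phi : cochain M n) :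
  resco M n.+1 (cobound phi) = cobound (resco M n phi).
Proof.
apply: cochain_ext => x z c.
transitivity (cobound_fun phi (chmap c)) => //.
transitivity (cobound_fun (resco M n phi) c) => //.
rewrite /cobound_fun chfirst_chmap chlast_chmap merges_chmap -map_comp.
congr (_ + _ + _ *: _).
- by case: (chfirst c) => y [f d].
- by case: (chlast c) => w [d g].
Qed.

Lemma resco_map M N (t : bimodmor M N) n (phi : cochain M n) :
  resco N n (cochain_map t phi) = cochain_map (resb_mor t) (resco M n phi).
Proof. exact: cochain_ext. Qed.

Variable Ji : forall x y, {linear mor E (J x) (J y) -> mor C x y}.
Hypothesis JK : forall x y, cancel (fmap J : mor C x y -> mor E (J x) (J y)) (Ji x y).
Hypothesis JiK : forall x y, cancel (Ji x y) (fmap J : mor C x y -> mor E (J x) (J y)).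
(** A partition of unity: the identity of [e] is a sum of composites u v with v from [e] to an
    object of the image of [J] and u back. It stands in for the identity wherever [e] itself is not
    in the image. *)
Variable dec : forall e, seq {x : obC & (mor E (J x) e * mor E e (J x))%type}.
Hypothesis decE : forall e,
  \sum_(t <- dec e) mcomp E (projT2 t).1 (projT2 t).2 = idm E e.

Lemma Ji_comp x y z (g : mor E (J y) (J z)) (f : mor E (J x) (J y)) :
  Ji _ _ (mcomp E g f) = mcomp C (Ji _ _ g) (Ji _ _ f).
Proof. by apply: (can_inj (@JK _ _)); rewrite fmap_comp !JiK. Qed.
Lemma Ji1 x : Ji _ _ (idm E (J x)) = idm C x.
Proof. by rewrite -fmap1 JK. Qed.

Lemma decl e e' (f : mor E e' e) :
  \sum_(t <- dec e) mcomp E (projT2 t).1 (mcomp E (projT2 t).2 f) = f.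
Proof.
rewrite -[RHS]mcomp1m -decE mcomp_suml.
by apply: eq_bigr => t _; rewrite mcompA.
Qed.
Lemma decr e e' (f : mor E e e') :
  \sum_(t <- dec e) mcomp E (mcomp E f (projT2 t).1) (projT2 t).2 = f.
Proof.
rewrite -[RHS]mcompm1 -decE mcomp_sumr.
by apply: eq_bigr => t _; rewrite mcompA.
Qed.

(** The retraction of [homb_cocycle] would evaluate p at g : J y -> e and then at the identity of
    [e], but p accepts only morphisms of [C]. Replacing the identity by the sum of the u v gives the
    sum of the values of p (v g) at u: fullness makes v g a morphism of [C], and u is an admissible
    argument of an element of [homb M]. *)
Lemma res_homb_cocycle (M : bimod E) n (phi : cochain (resb (homb M)) n.+1) :
  cobound phi = 0 -> exists psi, cobound psi = phi.
Proof.
have lin y x (p : bm (homb (resb (homb M))) y x) e : linear (fun g : mor E (J y) e =>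
    \sum_(t <- dec e) p (projT1 t) (Ji _ _ (mcomp E (projT2 t).2 g)) e (projT2 t).1).
  by apply: linear_sum_fun => t a f g; rewrite mcomp_linr !linearP.
pose s y x (p : bm (homb (resb (homb M))) y x) : bm (resb (homb M)) y x :=
  fun e => mklinear (lin y x p e).
have sl y x : linear (@s y x).
  move=> a p q; apply: homb_ext => e g /=.
  by rewrite scaler_sumr -big_split; apply: eq_bigr.
have sL x y z (f : mor C y z) p :
    mklinear (@sl z x) (lact (homb (resb (homb M))) f p)
    = lact (resb (homb M)) f (mklinear (@sl y x) p).
  apply: homb_ext => e g /=; apply: eq_bigr => t _.
  by rewrite mcompA Ji_comp JK.
have sR x y w p (g : mor C w x) :
    mklinear (@sl y w) (ract (homb (resb (homb M))) p g)
    = ract (resb (homb M)) (mklinear (@sl y x) p) g.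
  by apply: homb_ext => e h /=; rewrite (linf_sum (ract_linl _)).
apply: (@cocycle_retract _ _ _ _ _
  (@mkbimodmor _ _ _ (homb (resb (homb M))) (resb (homb M)) _ sL sR)).
move=> y x p; apply: homb_ext => e g /=.
rewrite -[in RHS](decl g) linear_sum; apply: eq_bigr => t _ /=.
by rewrite JiK.
Qed.

(** Injectivity and surjectivity of restriction on cohomology, stated on representatives so that the
    diagram chases avoid quotients. *)
Definition co_inj n M := forall phi : cochain M n, cobound phi = 0 ->
  is_cobound (resco M n phi) -> is_cobound phi.
Definition co_surj n M := forall phi : cochain (resb M) n, cobound phi = 0 ->
  exists psi, cobound psi = 0 /\ is_cobound (phi - resco M n psi).

(** A cocycle of degree 0 is a central family, so its value at [e] is the sum of the u (v phi_e) = u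
    (phi_x v), and phi_x = 0 for x in the image of [J]. *)
Lemma co_inj0 M : co_inj 0 M.
Proof.
move=> phi dphi /= r0; apply: cochain_ext => x z c; move: z c; apply: chain0_ind.
have cen e f (g : mor E e f) :
    lact M g (phi e e (chain0 E e)) = ract M (phi f f (chain0 E f)) g.
  by apply/eqP; rewrite -subr_eq0 -cobound0E dphi.
rewrite -[LHS]lact1 -decE (linf_sum (lact_linl _)) big1 // => t _.
rewrite lactA cen.
have -> : phi (J (projT1 t)) (J (projT1 t)) (chain0 E (J (projT1 t))) = 0.
  exact: (congr1 (fun chi : cochain (resb M) 0 => chi _ _ (chain0 C _)) r0).
by rewrite (linear_fun0 (ract_linl _)) (linear_fun0 (lact_linr _)).
Qed.

(** A central family over [C] extends to [E] by m_e, the sum of the u phi_x v. Since [J] is full,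
    phi commutes with every morphism between objects of the image; this gives v m_e = phi_x v for
    all v : e -> J x, from which centrality of m and its agreement with phi follow. *)
Lemma co_surj0 M : co_surj 0 M.
Proof.
move=> phi dphi.
have cen x y (g : mor C x y) : lact M (fmap J g) (phi x x (chain0 C x))
    = ract M (phi y y (chain0 C y)) (fmap J g).
  by apply/eqP; rewrite -subr_eq0 -[_ - _](cobound0E phi) dphi.
have cen' x y (g : mor E (J x) (J y)) : lact M g (phi x x (chain0 C x))
    = ract M (phi y y (chain0 C y)) g.
  by rewrite -(JiK g).
pose m e := \sum_(t <- dec e) lact M (projT2 t).1
  (ract M (phi (projT1 t) (projT1 t) (chain0 C (projT1 t))) (projT2 t).2).
have mact e x (v : mor E e (J x)) :
    lact M v (m e) = ract M (phi x x (chain0 C x)) v.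
  rewrite (linf_sum (lact_linr _)) -[in RHS](decr v) (linf_sum (ract_linr _)).
  by apply: eq_bigr => t _; rewrite -lactA -lractA cen' -ractA.
exists (cochain0 m); split.
  apply: cochain_ext => x z c; have [y [g [d ->]]] := chainSP c.
  move: y d g; apply: chain0_ind => g; rewrite cobound0E /=.
  apply/eqP; rewrite subr_eq0; apply/eqP.
  rewrite -[LHS]lact1 -decE (linf_sum (lact_linl _)) (linf_sum (ract_linl _)).
  apply: eq_bigr => t _.
  by rewrite lactA -(lactA (projT2 t).2) mact lractA -ractA.
apply/eqP; rewrite subr_eq0; apply/eqP; apply: cochain_ext => x z c.
move: z c; apply: chain0_ind => /=.
by rewrite -[RHS]lact1 mact ract1.
Qed.

Local Notation umap := (cochain_map (hom_unit _)).
Local Notation pmap := (cochain_map (hom_proj _)).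
Local Notation umap' := (cochain_map (resb_mor (hom_unit _))).
Local Notation pmap' := (cochain_map (resb_mor (hom_proj _))).

(** The injective half of the four lemma for H^n(Hom) -> H^n(Q) -> H^(n+1)(M) -> H^(n+1)(Hom), whose
    last term vanishes over [E], chased on cochains. *)
Lemma co_injS n M : co_surj n (homb M) -> co_inj n (qhomb M) -> co_inj n.+1 M.
Proof.
move=> hI hQ phi dphi [chi dchi].
have ai m : injective (@cochain_map _ _ _ m _ _ (hom_unit M)).
  by apply: cochain_map_inj => z x; apply: can_inj (@hom_unitK _ _ _ M z x).
have ba m (psi : cochain M m) : pmap (umap psi) = 0.
  by apply: cochain_ext => x z c; apply: hom_proj_unit.
have ba' m (psi : cochain (resb M) m) : pmap' (umap' psi) = 0.
  by apply: cochain_ext => x z c; apply: hom_proj_unit.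
have bs m (psi : cochain (qhomb M) m) : exists psi' : cochain _ m, pmap psi' = psi.
  by apply: (cochain_map_surj (s := hom_sect M)) => z x; apply: hom_projK.
have bex m (psi : cochain (homb M) m) : pmap psi = 0 -> exists psi', umap psi' = psi.
  by apply: (cochain_map_exact (r := hom_ev M)) => z x q; apply: hom_proj_ker.
have [al dal] : exists al, cobound al = umap phi.
  by apply: homb_cocycle; rewrite cobound_map dphi linear0.
(* Both the restriction of [al] and the image of [chi] are primitives of the restriction of u phi.
   Their difference is a cocycle, which comes from [E] up to a coboundary. *)
have [al' [dal' hal']] : exists psi, cobound psi = 0 /\
    is_cobound ((resco _ n al - umap' chi) - resco _ n psi).
  apply: hI; rewrite (linfB (@cobound_is_linear _ _ _ _ _)) -resco_cobound dal cobound_map dchi.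
  by rewrite resco_map subrr.
(* In Q the cocycle al - al' restricts to a coboundary, hence is one; lifting it to a coboundary
   [ep] makes al - al' - ep come from M. *)
have [ep [hep bep]] : exists ep, is_cobound ep /\ pmap ep = pmap (al - al').
  apply: is_cobound_lift; first exact: bs.
  apply: hQ.
    rewrite cobound_map (linfB (@cobound_is_linear _ _ _ _ _)) dal dal' subr0; exact: ba.
  rewrite resco_map.
  have -> : resco _ n (al - al') = (resco _ n al - umap' chi - resco _ n al') + umap' chi.
    by rewrite addrAC subrK linearB.
  rewrite linearD [X in _ + X]ba' addr0; exact: is_cobound_map.
have [chi' hchi'] : exists psi', umap psi' = al - al' - ep.
  by apply: bex; rewrite linearB [X in _ - X]bep subrr.
exists chi'; apply: ai; rewrite -[LHS]cobound_map [cochain_map _ _]hchi'.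
rewrite !(linfB (@cobound_is_linear _ _ _ _ _)) dal dal' subr0.
by rewrite (is_cobound_cobound hep) subr0.
Qed.

(** The surjective half of the four lemma: H^(n+1) of the restriction of Hom(E, M) vanishes, so
    every class over [C] comes from H^n of Q by the connecting map, and there restriction is
    surjective. *)
Lemma co_surjS n M : co_surj n (qhomb M) -> co_surj n.+1 M.
Proof.
move=> hQ phi dphi.
have ai m : injective (@cochain_map _ _ _ m _ _ (hom_unit M)).
  by apply: cochain_map_inj => z x; apply: can_inj (@hom_unitK _ _ _ M z x).
have ai' m : injective (@cochain_map _ _ _ m _ _ (resb_mor (hom_unit M))).
  by apply: cochain_map_inj => z x; apply: can_inj (@hom_unitK _ _ _ M _ _).
have ba' m (psi : cochain (resb M) m) : pmap' (umap' psi) = 0.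
  by apply: cochain_ext => x z c; apply: hom_proj_unit.
have bs m (psi : cochain (qhomb M) m) : exists psi' : cochain _ m, pmap psi' = psi.
  by apply: (cochain_map_surj (s := hom_sect M)) => z x; apply: hom_projK.
have bs' m (psi : cochain (resb (qhomb M)) m) : exists psi' : cochain _ m, pmap' psi' = psi.
  by apply: (@cochain_map_surj _ _ _ (resb (homb M)) (resb (qhomb M)) _
    (fun z x => hom_sect M (J z) (J x))) => z x; apply: hom_projK.
have bex m (psi : cochain (homb M) m) : pmap psi = 0 -> exists psi', umap psi' = psi.
  by apply: (cochain_map_exact (r := hom_ev M)) => z x q; apply: hom_proj_ker.
have bex' m (psi : cochain (resb (homb M)) m) : pmap' psi = 0 -> exists psi', umap' psi' = psi.
  apply: (@cochain_map_exact _ _ _ (resb M) (resb (homb M)) (resb (qhomb M)) _ _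
    (fun z x => hom_ev M (J z) (J x))) => z x q.
  exact: hom_proj_ker.
have [al dal] : exists al, cobound al = umap' phi.
  by apply: res_homb_cocycle; rewrite cobound_map dphi linear0.
have [be [dbe hbe]] : exists psi, cobound psi = 0 /\ is_cobound (pmap' al - resco _ n psi).
  by apply: hQ; rewrite cobound_map dal; apply: ba'.
have [psi [hpsi bpsi]] := is_cobound_lift bs' hbe.
have [bt hbt] := bs _ be.
have [chi hchi] : exists chi, umap' chi = al - psi - resco _ n bt.
  apply: bex'; rewrite !linearB [X in _ - X - _]bpsi -[X in _ - X]resco_map.
  by rewrite hbt subKr subrr.
(* The connecting map applied to the class of [be]: d bt maps to d be = 0 in Q, so it comes from
   M. *)
have [phi' hphi'] : exists phi', umap phi' = cobound bt.
  by apply: bex; rewrite -[LHS]cobound_map [cochain_map _ _]hbt.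
exists phi'; split.
  apply: ai; rewrite -[LHS]cobound_map [cochain_map _ _]hphi' coboundK.
  by apply/esym; apply: linear0.
exists chi; apply: ai'; rewrite -[LHS]cobound_map [cochain_map _ _]hchi.
rewrite !(linfB (@cobound_is_linear _ _ _ _ _)) dal (is_cobound_cobound hpsi) subr0.
by rewrite -resco_cobound -hphi' linearB; congr (_ - _); apply: resco_map.
Qed.

Theorem resco_quasi_iso n M : co_inj n M /\ co_surj n M.
Proof.
elim: n M => [|n IH] M; first by split; [apply: co_inj0|apply: co_surj0].
split; first by apply: co_injS; [case: (IH (homb M))|case: (IH (qhomb M))].
by apply: co_surjS; case: (IH (qhomb M)).
Qed.

End Restriction.

(** * Natural isomorphisms of homology functors *)

Section HomologyMapIso.
Variables (k : fieldType) (U V W U' V' W' : lmodType k).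
Variables (f : {linear U -> V}) (g : {linear V -> W}).
Variables (f' : {linear U' -> V'}) (g' : {linear V' -> W'}).
Variables (a : {linear U -> U'}) (b : {linear V -> V'}) (c : {linear W -> W'}).
Hypothesis ab : forall u, b (f u) = f' (a u).
Hypothesis bc : forall v, c (g v) = g' (b v).

Lemma homology_mapE (z : cycles g) :
  homology_map ab bc (qclass _ z) = qclass _ (cycles_map_fun bc z).
Proof. exact: qmapE. Qed.

Lemma homology_map_iso :
  (forall v, g v = 0 -> (exists u', f' u' = b v) -> exists u, f u = v) ->
  (forall v', g' v' = 0 -> exists v, g v = 0 /\ exists u', f' u' = v' - b v) ->
  @is_iso k _ (vectcat k) _ _ (homology_map ab bc).
Proof.
move=> inj surj; apply: vectcat_iso; last first.
  move=> q; rewrite -[q]qreprK; case: (qrepr q) => v' /= hv'.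
  have /eqP gv' := hv'; have [v [/eqP gv [u' fu']]] := surj v' gv'.
  exists (qclass _ (@Cycle _ _ _ g v gv)); rewrite homology_mapE; apply/qclass_eqP.
  by apply/asboolP; exists (- u'); rewrite linearN fu' opprB.
suff ker0 q : homology_map ab bc q = 0 -> q = 0.
  move=> p q e; apply/eqP; rewrite -subr_eq0; apply/eqP; apply: ker0.
  by rewrite linearB; apply/eqP; rewrite subr_eq0; apply/eqP.
have q0 (X : lmodType k) (S : submodClosed X) : 0 = qclass S 0 by rewrite linear0.
rewrite -[q]qreprK homology_mapE !q0 => /qclass_eqP; rewrite subr0 => /asboolP[u' fu'].
have [|u fu] := inj (cycle_val (qrepr q)) _ (ex_intro _ u' fu').
  by case: (qrepr q) => v /= /eqP.
by apply/qclass_eqP; rewrite subr0; apply/asboolP; exists u.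
Qed.
End HomologyMapIso.

Section HomologyNatIso.
Variables (k : fieldType) (obA obA' obB : Type).
Variables (A : lincat k obA) (A' : lincat k obA') (B : lincat k obB).
Variables (F0 F1 F2 : linfunctor A (vectcat k)) (G0 G1 G2 : linfunctor A' (vectcat k)).
Variables (f : forall M, {linear F0 M -> F1 M}) (g : forall M, {linear F1 M -> F2 M}).
Variables (f' : forall M, {linear G0 M -> G1 M}) (g' : forall M, {linear G1 M -> G2 M}).
Hypotheses (nf : @natural k _ _ A (vectcat k) F0 F1 f).
Hypotheses (ng : @natural k _ _ A (vectcat k) F1 F2 g).
Hypotheses (nf' : @natural k _ _ A' (vectcat k) G0 G1 f').
Hypotheses (ng' : @natural k _ _ A' (vectcat k) G1 G2 g').
Variables (H : linfunctor B A) (H' : linfunctor B A').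
Variables (a : forall M, {linear F0 (H M) -> G0 (H' M)}).
Variables (b : forall M, {linear F1 (H M) -> G1 (H' M)}).
Variables (c : forall M, {linear F2 (H M) -> G2 (H' M)}).
Hypothesis ab : forall M u, b M (f (H M) u) = f' (H' M) (a M u).
Hypothesis bc : forall M v, c M (g (H M) v) = g' (H' M) (b M v).
Hypothesis nb : forall M N (t : mor B M N) v,
  (fmap G1 (fmap H' t) : {linear _ -> _}) (b M v)
  = b N ((fmap F1 (fmap H t) : {linear _ -> _}) v).
Hypothesis inj : forall M v, g (H M) v = 0 ->
  (exists u', f' (H' M) u' = b M v) -> exists u, f (H M) u = v.
Hypothesis surj : forall M v', g' (H' M) v' = 0 ->
  exists v, g (H M) v = 0 /\ exists u', f' (H' M) u' = v' - b M v.

(** The functors [H] and [H'] pull both homologies back to one category of coefficients. Two of them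
    are needed because restriction of cochains goes from [E] to [C] and inclusion of chains from [C]
    to [E]. *)
Lemma homologyF_iso :
  nat_isomorphic (compfunctor (homologyF nf ng) H) (compfunctor (homologyF nf' ng') H').
Proof.
exists (fun M => homology_map (@ab M) (@bc M)); split=> [M N t|M].
  apply: linear_ext => q; rewrite -(qreprK q); move: (qrepr q) => z.
  transitivity (hf_map nf' ng' (fmap H' t) (homology_map (@ab M) (@bc M) (qclass _ z))) => //.
  transitivity (homology_map (@ab N) (@bc N) (hf_map nf ng (fmap H t) (qclass _ z))) => //.
  rewrite !(homology_mapE, hf_mapE); congr qclass; apply: val_inj; exact: nb.
by apply: homology_map_iso; [apply: inj|apply: surj].
Qed.
End HomologyNatIso.

Section FullyFaithful.
Variables (k : fieldType) (obC obE : Type) (C : lincat k obC) (E : lincat k obE).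
Variable J : linfunctor C E.
Variable Ji : forall x y, {linear mor E (J x) (J y) -> mor C x y}.
Hypothesis JK : forall x y, cancel (fmap J : mor C x y -> mor E (J x) (J y)) (Ji x y).
Hypothesis JiK : forall x y, cancel (Ji x y) (fmap J : mor C x y -> mor E (J x) (J y)).
Variable dec : forall e, seq {x : obC & (mor E (J x) e * mor E e (J x))%type}.
Hypothesis decE : forall e,
  \sum_(t <- dec e) mcomp E (projT2 t).1 (projT2 t).2 = idm E e.

Lemma HHco_res n : nat_isomorphic (compfunctor (HHco C n) (resF J)) (HHco E n).
Proof.
apply: nat_iso_sym; apply: nat_iso_trans (nat_iso_sym (compfunctorm1 _)) _.
have qi m := resco_quasi_iso JK JiK decE m.
case: n => [|n].
  apply: (@homologyF_iso _ _ _ _ (bimodcat E) (bimodcat C) (bimodcat E)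
    (cochainF E 0) (cochainF E 0) (cochainF E 1)
    (cochainF C 0) (cochainF C 0) (cochainF C 1)
    _ _ _ _ _ _ _ _ (idfunctor _) (resF J)
    (fun M => resco J M 0) (fun M => resco J M 0) (fun M => resco J M 1)).
  - by move=> M u; rewrite linear0.
  - by move=> M v; apply: resco_cobound.
  - by move=> M N t v; apply: cochain_ext.
  (* The incoming differential is zero here, so the preimage may be taken to be 0 and the claim is v
     = 0. *)
  - move=> M v dv [u' /= e]; exists 0 => /=; apply/esym.
    by apply: (qi 0%N M).1 => //=; rewrite -e.
  move=> M v' dv'; have [v [dv hv]] := (qi 0%N M).2 v' dv'.
  by exists v; split=> //; exists 0 => /=; rewrite -hv.
apply: (@homologyF_iso _ _ _ _ (bimodcat E) (bimodcat C) (bimodcat E)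
    (cochainF E n) (cochainF E n.+1) (cochainF E n.+2)
    (cochainF C n) (cochainF C n.+1) (cochainF C n.+2)
    _ _ _ _ _ _ _ _ (idfunctor _) (resF J)
  (fun M => resco J M n) (fun M => resco J M n.+1) (fun M => resco J M n.+2)).
- by move=> M u; apply: resco_cobound.
- by move=> M v; apply: resco_cobound.
- by move=> M N t v; apply: cochain_ext.
- by move=> M; apply: (qi n.+1 M).1.
by move=> M v' dv'; apply: (qi n.+1 M).2.
Qed.

End FullyFaithful.

Section Cokernel.
Variables (k : fieldType) (U V : lmodType k) (f : {linear U -> V}).
Definition image_pred : {pred V} := fun v => `[< exists u, f u = v >].
Fact image_closed : submod_closed image_pred.
Proof.
split=> [|a v w /asboolP[u <-] /asboolP[u' <-]]; apply/asboolP.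
  by exists 0; rewrite linear0.
by exists (a *: u + u'); rewrite linearP.
Qed.
HB.instance Definition _ := GRing.isSubmodClosed.Build k V image_pred image_closed.
Definition coker : lmodType k := quotl image_pred.
Definition to_coker : {linear V -> coker} := @qclass k V image_pred.

Lemma to_cokerP v : to_coker v = 0 <-> exists u, f u = v.
Proof.
rewrite -[0](linear0 to_coker).
by split=> [/qclass_eqP|[u fu]]; [|apply/qclass_eqP]; rewrite subr0 => //;
  [move/asboolP | apply/asboolP; exists u].
Qed.
End Cokernel.

(** * From cohomology to homology *)

Section DualQuasiIso.
Variables (k : fieldType) (K2 K1 K0 L2 L1 L0 : lmodType k).
Variables (dK2 : {linear K2 -> K1}) (dK1 : {linear K1 -> K0}).
Variables (dL2 : {linear L2 -> L1}) (dL1 : {linear L1 -> L0}).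
Variables (i1 : {linear K1 -> L1}).

(** Together with [dual_surj], this says that [i1] induces an isomorphism on the middle cohomology
    of Hom(-, V) for every V; the maps that factor through the outgoing differential are the
    coboundaries. *)
Definition dual_inj := forall (V : lmodType k) (l : {linear L1 -> V}),
  (forall u, l (dL2 u) = 0) ->
  (exists mu : {linear K0 -> V}, forall v, l (i1 v) = mu (dK1 v)) ->
  exists nu : {linear L0 -> V}, forall v, l v = nu (dL1 v).
Definition dual_surj := forall (V : lmodType k) (l : {linear K1 -> V}),
  (forall u, l (dK2 u) = 0) ->
  exists l' : {linear L1 -> V}, (forall u, l' (dL2 u) = 0) /\
    exists mu : {linear K0 -> V}, forall v, l v - l' (i1 v) = mu (dK1 v).

(* Apply [dual_surj] to the projection onto the cokernel of [dK2]. *)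
Lemma dual_quasi_iso_inj v : dual_surj ->
  dK1 v = 0 -> (exists u', dL2 u' = i1 v) -> exists u, dK2 u = v.
Proof.
move=> surj dv [u' du']; apply/to_cokerP.
have [u|l' [l'd [mu hmu]]] := surj _ (to_coker dK2).
  by apply/to_cokerP; exists u.
have := hmu v; rewrite dv linear0 -du' l'd subr0; exact.
Qed.

(* The test space is the cokernel of [(u, v) |-> (dL2 u + i1 v, - dK1 v)], in which
   [i1 v] and [dK1 v] are identified: there the class of [L1], pulled back along
   [i1], factors through [dK1]. *)
Lemma dual_quasi_iso_surj v' : dual_inj ->
  dL1 v' = 0 -> exists v, dK1 v = 0 /\ exists u', dL2 u' = v' - i1 v.
Proof.
move=> inj dv'.
have jl : linear (fun p : L2 * K1 => (dL2 p.1 + i1 p.2, - dK1 p.2) : L1 * K0).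
  move=> a [u v] [w x]; congr (_, _) => /=.
    by rewrite !linearP scalerDr addrACA.
  by rewrite linearP opprD scalerN.
pose j := mklinear jl.
have pl1 : linear (fun v : L1 => to_coker j (v, 0)).
  by move=> a v w; rewrite -linearP; congr (to_coker j (_, _)) => /=; rewrite scaler0 addr0.
have pl0 : linear (fun v : K0 => to_coker j (0, v)).
  by move=> a v w; rewrite -linearP; congr (to_coker j (_, _)) => /=; rewrite scaler0 addr0.
have [||nu hnu] := inj _ (mklinear pl1).
- by move=> u /=; apply/to_cokerP; exists (u, 0); rewrite /= !linear0 addr0.
- exists (mklinear pl0) => v /=; apply/eqP; rewrite -subr_eq0 -linearB; apply/eqP.
  apply/to_cokerP; exists (0, v); congr (_, _) => /=.
    by rewrite linear0 add0r subr0.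
  by rewrite sub0r.
have := hnu v'; rewrite dv' linear0 /= => /to_cokerP[[u v] [hv' hv]].
exists v; split; first by apply/eqP; rewrite -oppr_eq0 hv.
by exists u; rewrite -hv' addrK.
Qed.
End DualQuasiIso.

(** * Chains against cochains with dual coefficients *)

Section Dual.
Variables (k : fieldType) (ob : Type) (C : lincat k ob) (M : bimod C) (V : lmodType k).

(** The indices are exchanged because Hom(-, V) turns right actions into left ones. *)
Definition dualbm z x : lmodType k := {linear bm M x z -> V}.
Definition dual_lact x y z (f : mor C y z) (p : dualbm y x) : dualbm z x :=
  p \o mklinear (ract_linl (b := M) f).
Definition dual_ract x y w (p : dualbm y x) (g : mor C w x) : dualbm y w :=
  p \o mklinear (lact_linr (b := M) (x := y) g).
Program Definition dualb : bimod C := @Bimod k ob C dualbm dual_lact dual_ract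
  _ _ _ _ _ _ _ _ _.
Next Obligation.
by move=> x y z p a f g; apply: linear_ext => m /=; rewrite ract_linr linearP.
Qed.
Next Obligation. by move=> x y z f a p q; apply: linear_ext. Qed.
Next Obligation. by move=> x y w g a p q; apply: linear_ext. Qed.
Next Obligation.
by move=> x y w p a f g; apply: linear_ext => m /=; rewrite lact_linl linearP.
Qed.
Next Obligation. by move=> x y p; apply: linear_ext => m /=; rewrite ract1. Qed.
Next Obligation. by move=> x y z t g f p; apply: linear_ext => m /=; rewrite ractA. Qed.
Next Obligation. by move=> x y p; apply: linear_ext => m /=; rewrite lact1. Qed.
Next Obligation. by move=> x y w v p f g; apply: linear_ext => m /=; rewrite lactA. Qed.
Next Obligation. by move=> x y z w f p g; apply: linear_ext => m /=; rewrite lractA. Qed.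

Section DualCochain.
Variable n : nat.

Definition dual_cochain_fun (l : {linear hchains M n -> V}) x z (c : chain C x n z) :
    bm dualb z x :=
  mklinear (fun a m1 m2 => etrans (congr1 l (pure_lin_elt a m1 m2 c)) (linearP l _ _ _)).
Fact dual_cochain_proof l :
  (dual_cochain_fun l : dprod _) \in @cochain_pred _ _ _ dualb n.
Proof.
apply/asboolP => a x z c1 c2 c3 h; apply: linear_ext => m /=.
by rewrite (pure_lin_chain m h) linearP.
Qed.
Definition dual_cochain l : cochain dualb n := Cochain (dual_cochain_proof l).

Lemma dual_cochainE l x z (c : chain C x n z) (m : bm M x z) :
  (dual_cochain l x z c : dualbm z x) m = l (pure (CWord m c)).
Proof. by []. Qed.

Lemma dual_cochain_inj : injective dual_cochain.
Proof.
move=> l l' e; apply: hchains_ext => -[x z m c].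
by rewrite -!dual_cochainE e.
Qed.

Lemma dual_cochain_surj (phi : cochain dualb n) : exists l, dual_cochain l = phi.
Proof.
pose F (w : cword M n) : V := let: CWord x z m c := w in (phi x z c : dualbm z x) m.
have F1 a x z (m1 m2 : bm M x z) (c : chain C x n z) :
    F (CWord (a *: m1 + m2) c) = a *: F (CWord m1 c) + F (CWord m2 c).
  by rewrite /= linearP.
have F2 a x z (m : bm M x z) (c1 c2 c3 : chain C x n z) : chlin a c1 c2 c3 ->
    F (CWord m c3) = a *: F (CWord m c1) + F (CWord m c2).
  by move=> h; rewrite /= (cochainP phi h).
exists (hlift F1 F2); apply: cochain_ext => x z c; apply: linear_ext => m.
by rewrite dual_cochainE hliftE.
Qed.

Lemma dual_cochain_linear : linear dual_cochain.
Proof. by move=> a l l'; apply: cochain_ext => x z c; apply: linear_ext. Qed.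
End DualCochain.

(** The differentials match term by term, without signs: the left action on the dual is
    precomposition with the right action on [M], which identifies the first terms, and symmetrically
    for the last. *)
Lemma cobound_dual n (l : {linear hchains M n -> V}) :
  cobound (dual_cochain l) = dual_cochain (l \o hbound M n).
Proof.
apply: cochain_ext => x z c; apply: linear_ext => m.
transitivity (l (hbound M n (pure (CWord m c)))) => //.
have evl : linear (fun q : dualbm z x => q m) by [].
have [ev evE] : exists ev : {linear bm dualb z x -> V}, forall q, ev q = (q : dualbm z x) m.
  by exists (mklinear evl).
transitivity (ev (cobound_fun (dual_cochain l) c)); first by rewrite evE.
rewrite hliftE /hbound_word /cobound_fun !linearD !linear_sum !linearZ_LR.
congr (_ + _ + _ *: _).
- by rewrite evE; case: (chfirst c) => y [f d].
- apply: eq_bigr => i _; rewrite !linearZ_LR -(nth_map0 ev) -(nth_map0 l) -!map_comp.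
  by congr (_ *: _`_i); apply: eq_map => d; rewrite /= evE.
by rewrite evE; case: (chlast c) => w [d g].
Qed.

Definition is_dbound n : {linear hchains M n -> V} -> Prop :=
  match n with
  | 0 => fun l => l = 0
  | m.+1 => fun l => exists nu : {linear hchains M m -> V}, l = nu \o hbound M m
  end.

Lemma is_cobound_dual n (l : {linear hchains M n -> V}) :
  is_cobound (dual_cochain l) <-> is_dbound l.
Proof.
case: n l => [|n] l /=; split.
- rewrite -(linear_fun0 (@dual_cochain_linear 0)); exact: dual_cochain_inj.
- by move=> ->; apply: (linear_fun0 (@dual_cochain_linear 0)).
- move=> [psi]; have [nu <-] := dual_cochain_surj psi.
  by rewrite cobound_dual => /dual_cochain_inj <-; exists nu.
by move=> [nu ->]; exists (dual_cochain nu); rewrite cobound_dual.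
Qed.

Lemma cocycle_dual n (l : {linear hchains M n -> V}) :
  cobound (dual_cochain l) = 0 <-> forall u, l (hbound M n u) = 0.
Proof.
rewrite cobound_dual -(linear_fun0 (@dual_cochain_linear n.+1)); split.
  by move=> /dual_cochain_inj e u; apply: (congr1 (fun h : {linear _ -> V} => h u) e).
by move=> e; congr dual_cochain; apply: linear_ext.
Qed.
End Dual.

Section ChainInclusion.
Variables (k : fieldType) (obC obE : Type) (C : lincat k obC) (E : lincat k obE).
Variable J : linfunctor C E.

Section Inclusion.
Variables (M : bimod E) (n : nat).
Definition hincl_word (w : cword (resb J M) n) : hchains M n :=
  let: CWord x z m c := w in pure (@CWord _ _ _ M n (J x) (J z) m (chmap J c)).
Fact hincl_elt a x z (m1 m2 : bm (resb J M) x z) (c : chain C x n z) :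
  hincl_word (CWord (a *: m1 + m2) c) = a *: hincl_word (CWord m1 c) + hincl_word (CWord m2 c).
Proof. exact: pure_lin_elt. Qed.
Fact hincl_chain a x z (m : bm (resb J M) x z) (c1 c2 c3 : chain C x n z) :
  chlin a c1 c2 c3 ->
  hincl_word (CWord m c3) = a *: hincl_word (CWord m c1) + hincl_word (CWord m c2).
Proof. by move=> h; apply: pure_lin_chain; apply: chlin_chmap. Qed.
Definition hincl : {linear hchains (resb J M) n -> hchains M n} :=
  hlift hincl_elt hincl_chain.
End Inclusion.

Section Dual.
Variables (M : bimod E) (V : lmodType k).

(** Both bimodules have the same entries and their actions agree pointwise, so the identity maps
    form a morphism. *)
Definition dual_resb : bimodmor (dualb (resb J M) V) (resb J (dualb M V)).
Proof.
apply: (@mkbimodmor _ _ _ (dualb (resb J M) V) (resb J (dualb M V)) (fun y x => idfun)).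
- by move=> x y z f p; apply: linear_ext.
- by move=> x y w p g; apply: linear_ext.
Defined.

Lemma dual_resb_surj n (phi : cochain (resb J (dualb M V)) n) :
  exists psi, cochain_map dual_resb psi = phi.
Proof.
by apply: (@cochain_map_surj _ _ _ (dualb (resb J M) V) (resb J (dualb M V)) _
  (fun z x => idfun)).
Qed.

Lemma dual_resb_inj n : injective (@cochain_map _ _ _ n _ _ dual_resb).
Proof. by apply: cochain_map_inj => z x p q. Qed.

Lemma dual_hincl n (l : {linear hchains M n -> V}) :
  resco J _ n (dual_cochain l) = cochain_map dual_resb (dual_cochain (l \o hincl M n)).
Proof.
apply: cochain_ext => x z c; apply: linear_ext => m.
transitivity (l (hincl M n (pure (@CWord _ _ _ (resb J M) n x z m c)))) => //.
by rewrite hliftE.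
Qed.
End Dual.

(** Obtained from [resco_cobound] by duality, with the identity of [hchains M n] as the test map,
    instead of expanding boundaries of words. *)
Lemma hincl_bound M n (v : hchains (resb J M) n.+1) :
  hincl M n (hbound (resb J M) n v) = hbound M n (hincl M n.+1 v).
Proof.
have := congr1 (@cobound _ _ _ _ _) (dual_hincl (idfun : {linear hchains M n -> _})).
rewrite -resco_cobound cobound_dual dual_hincl cobound_map cobound_dual.
move/dual_resb_inj/dual_cochain_inj => e.
exact: (esym (congr1 (fun h : {linear _ -> hchains M n} => h v) e)).
Qed.

Lemma hincl_map M N (t : bimodmor M N) n (v : hchains (resb J M) n) :
  hchain_map n t (hincl M n v) = hincl N n (hchain_map n (resb_mor J t) v).
Proof.
pose l1 : {linear hchains (resb J M) n -> hchains N n} := hchain_map n t \o hincl M n.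
pose l2 : {linear hchains (resb J M) n -> hchains N n} :=
  hincl N n \o hchain_map n (resb_mor J t).
suff e : l1 = l2.
  exact: (congr1 (fun h : {linear hchains (resb J M) n -> hchains N n} => h v) e).
apply: hchains_ext => -[x z m c].
transitivity (hchain_map n t (hincl M n (pure (CWord m c)))) => //.
transitivity (hincl N n (hchain_map n (resb_mor J t) (pure (CWord m c)))) => //.
by rewrite !hliftE.
Qed.

Variable Ji : forall x y, {linear mor E (J x) (J y) -> mor C x y}.
Hypothesis JK : forall x y, cancel (fmap J : mor C x y -> mor E (J x) (J y)) (Ji x y).
Hypothesis JiK : forall x y, cancel (Ji x y) (fmap J : mor C x y -> mor E (J x) (J y)).
Variable dec : forall e, seq {x : obC & (mor E (J x) e * mor E e (J x))%type}.
Hypothesis decE : forall e,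
  \sum_(t <- dec e) mcomp E (projT2 t).1 (projT2 t).2 = idm E e.

Lemma dual_incl_inj M (V : lmodType k) n (l : {linear hchains M n -> V}) :
  (forall u, l (hbound M n u) = 0) -> is_dbound (l \o hincl M n) -> is_dbound l.
Proof.
move=> /cocycle_dual hl /is_cobound_dual hi; apply/is_cobound_dual.
apply: (resco_quasi_iso JK JiK decE n (dualb M V)).1 => //.
by rewrite dual_hincl; apply: is_cobound_map.
Qed.

Lemma dual_incl_surj M (V : lmodType k) n (l : {linear hchains (resb J M) n -> V}) :
  (forall u, l (hbound _ n u) = 0) ->
  exists l' : {linear hchains M n -> V}, (forall u, l' (hbound M n u) = 0) /\
    is_dbound (l - (l' \o hincl M n : {linear _ -> _})).
Proof.
move=> /cocycle_dual hl.
have [|psi [dpsi hpsi]] :=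
    (resco_quasi_iso JK JiK decE n (dualb M V)).2 (cochain_map (dual_resb M V) (dual_cochain l)).
  by rewrite cobound_map hl linear0.
have [l' el'] := dual_cochain_surj psi; exists l'; split.
  by apply/cocycle_dual; rewrite el'.
apply/is_cobound_dual; rewrite (linfB (@dual_cochain_linear _ _ _ _ _ _)).
move: hpsi; rewrite -el' dual_hincl -linearB.
case: n l hl psi dpsi l' el' => [|n] l hl psi dpsi l' el' /=.
  by rewrite -[0](linear0 (@cochain_map _ _ _ _ _ _ (dual_resb M V))) => /dual_resb_inj.
move=> [chi]; have [chi' <-] := dual_resb_surj chi.
by rewrite cobound_map => /dual_resb_inj <-; exists chi'.
Qed.

Lemma HHho_res n : nat_isomorphic (compfunctor (HHho C n) (resF J)) (HHho E n).
Proof.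
apply: nat_iso_trans (compfunctorm1 _).
case: n => [|n].
  apply: (@homologyF_iso _ _ _ _ (bimodcat C) (bimodcat E) (bimodcat E)
    (hchainF C 1) (hchainF C 0) (hchainF C 0)
    (hchainF E 1) (hchainF E 0) (hchainF E 0)
    _ _ _ _ _ _ _ _ (resF J) (idfunctor _)
    (fun M => hincl M 1) (fun M => hincl M 0) (fun M => hincl M 0)).
  - by move=> M u; apply: hincl_bound.
  - by move=> M v; apply: (linear0 (hincl M 0)).
  - by move=> M N t v; apply: hincl_map.
  - move=> M v; apply: dual_quasi_iso_inj => V l hl.
    have [l' [hl' e]] := dual_incl_surj hl; exists l'; split=> //.
    exists 0 => w; exact: (congr1 (fun h : {linear _ -> V} => h w) e).
  move=> M v'; apply: dual_quasi_iso_surj => V l hl [mu hmu].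
  exists 0 => w; have -> // : l = 0.
  by apply: dual_incl_inj hl _ => /=; apply: linear_ext => w' /=; rewrite hmu linear0.
apply: (@homologyF_iso _ _ _ _ (bimodcat C) (bimodcat E) (bimodcat E)
    (hchainF C n.+2) (hchainF C n.+1) (hchainF C n)
    (hchainF E n.+2) (hchainF E n.+1) (hchainF E n)
    _ _ _ _ _ _ _ _ (resF J) (idfunctor _)
    (fun M => hincl M n.+2) (fun M => hincl M n.+1) (fun M => hincl M n)).
- by move=> M u; apply: hincl_bound.
- by move=> M v; apply: hincl_bound.
- by move=> M N t v; apply: hincl_map.
- move=> M v; apply: dual_quasi_iso_inj => V l hl.
  have [l' [hl' [mu e]]] := dual_incl_surj hl; exists l'; split=> //.
  exists mu => w; exact: (congr1 (fun h : {linear _ -> V} => h w) e).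
move=> M v'; apply: dual_quasi_iso_surj => V l hl [mu hmu].
have [nu e] : is_dbound (l : {linear hchains M n.+1 -> V}).
  by apply: dual_incl_inj hl _ => /=; exists mu; apply: linear_ext => w' /=; rewrite hmu.
by exists nu => w; rewrite e.
Qed.

End ChainInclusion.

(** * Coinduction of bimodules *)

Section Coinduction.
Variables (k : fieldType) (obC obE : Type) (C : lincat k obC) (E : lincat k obE).
Variable J : linfunctor C E.

Section Coind.
Variable N : bimod C.

Section CoindModule.
Variables d e : obE.
Local Notation T := (dprod (fun y => dprod (fun x => dprod (fun _ : mor E d (J y) =>
  dprod (fun _ : mor E (J x) e => bm N y x))))).

(** The entry of the coinduced bimodule at (d, e) consists of the bilinear families E(d, J y) x E(J
    x, e) -> {}_yN_x that are natural in y and x. Coinduction is a space of functions, whereas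
    induction would call for tensor products over [C]. *)
Record biequivariant (p : T) : Prop := Biequivariant {
  coind_linl : forall y x h, linear (fun g => p y x g h);
  coind_linr : forall y x g, linear (p y x g);
  coind_lact : forall y z x (a : mor C y z) g h,
    p z x (mcomp E (fmap J a) g) h = lact N a (p y x g h);
  coind_ract : forall y x w (b : mor C w x) g h,
    p y w g (mcomp E h (fmap J b)) = ract N (p y x g h) b
}.
Definition coind_pred : {pred T} := fun p => `[< biequivariant p >].

Fact coind_closed : submod_closed coind_pred.
Proof.
split=> [|c p q /asboolP[p1 p2 p3 p4] /asboolP[q1 q2 q3 q4]]; apply/asboolP; split.
- by move=> y x h a g g'; rewrite scaler0 addr0.
- by move=> y x g a h h'; rewrite !dprod0E scaler0 addr0.
- by move=> y z x a g h; rewrite !dprod0E (linear_fun0 (lact_linr _)).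
- by move=> y x w b g h; rewrite !dprod0E (linear_fun0 (ract_linl _)).
- move=> y x h a g g'; rewrite !dprodDE !dprodZE p1 q1.
  by rewrite !scalerDr !scalerA [c * a]mulrC addrACA.
- move=> y x g a h h'; rewrite !dprodDE !dprodZE p2 q2.
  by rewrite !scalerDr !scalerA [c * a]mulrC addrACA.
- by move=> y z x a g h; rewrite !dprodDE !dprodZE lact_linr p3 q3.
- by move=> y x w b g h; rewrite !dprodDE !dprodZE ract_linl p4 q4.
Qed.
HB.instance Definition _ := GRing.isSubmodClosed.Build k T coind_pred coind_closed.

Record coindm := Coindm { coind_fun :> T; _ : coind_fun \in coind_pred }.
HB.instance Definition _ := [isSub for coind_fun].
HB.instance Definition _ := [Choice of coindm by <:].
HB.instance Definition _ := [SubChoice_isSubLmodule of coindm by <:].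

Lemma coindmP (p : coindm) : biequivariant p.
Proof. by case: p => p /= /asboolP. Qed.

Lemma coindm_ext (p q : coindm) : (forall y x g h, p y x g h = q y x g h) -> p = q.
Proof.
move=> e'; apply: val_inj; do 4!apply: functional_extensionality_dep => ?; exact: e'.
Qed.
End CoindModule.

Fact coindb_lact_proof x y z (f : mor E y z) (p : coindm y x) :
  ((fun u v g h => p u v (mcomp E g f) h) : dprod _) \in @coind_pred z x.
Proof.
have [p1 p2 p3 p4] := coindmP p; apply/asboolP; split.
- by move=> u v h a g g'; rewrite mcomp_linl p1.
- by move=> u v g; apply: p2.
- by move=> u w v a g h; rewrite -mcompA p3.
- by move=> u v w b g h; apply: p4.
Qed.
Definition coindb_lact x y z (f : mor E y z) (p : coindm y x) : coindm z x :=
  Coindm (coindb_lact_proof f p).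

Fact coindb_ract_proof x y w (p : coindm y x) (f : mor E w x) :
  ((fun u v g h => p u v g (mcomp E f h)) : dprod _) \in @coind_pred y w.
Proof.
have [p1 p2 p3 p4] := coindmP p; apply/asboolP; split.
- by move=> u v h; apply: p1.
- by move=> u v g a h h'; rewrite mcomp_linr p2.
- by move=> u w' v a g h; apply: p3.
- by move=> u v w' b g h; rewrite mcompA p4.
Qed.
Definition coindb_ract x y w (p : coindm y x) (f : mor E w x) : coindm y w :=
  Coindm (coindb_ract_proof p f).

Program Definition coindb : bimod E := @Bimod k obE E (fun d e => coindm d e)
  coindb_lact coindb_ract _ _ _ _ _ _ _ _ _.
Next Obligation.
move=> x y z p a f g; apply: coindm_ext => u v h h' /=.
by rewrite mcomp_linr (coind_linl (coindmP p)).
Qed.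
Next Obligation. by move=> x y z f a p q; apply: coindm_ext. Qed.
Next Obligation. by move=> x y w g a p q; apply: coindm_ext. Qed.
Next Obligation.
move=> x y w p a f g; apply: coindm_ext => u v h h' /=.
by rewrite mcomp_linl (coind_linr (coindmP p)).
Qed.
Next Obligation. by move=> x y p; apply: coindm_ext => u v h h' /=; rewrite mcompm1. Qed.
Next Obligation. by move=> x y z t g f p; apply: coindm_ext => u v h h' /=; rewrite mcompA. Qed.
Next Obligation. by move=> x y p; apply: coindm_ext => u v h h' /=; rewrite mcomp1m. Qed.
Next Obligation. by move=> x y w v p f g; apply: coindm_ext => u u' h h' /=; rewrite mcompA. Qed.
Next Obligation. by move=> x y z w f p g; apply: coindm_ext. Qed.
End Coind.

Section CoindMor.
Variables (M N : bimod C) (t : mor (bimodcat C) M N).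
Fact coind_mor_proof d e (p : coindm M d e) :
  ((fun y x g h => t y x (p y x g h)) : dprod _) \in @coind_pred N d e.
Proof.
have [p1 p2 p3 p4] := coindmP p; apply/asboolP; split.
- by move=> u v h a g g'; rewrite p1 linearP.
- by move=> u v g a h h'; rewrite p2 linearP.
- by move=> u w v a g h; rewrite p3 bimodmor_lact.
- by move=> u v w b g h; rewrite p4 bimodmor_ract.
Qed.
Definition coind_mor_fun d e (p : coindm M d e) : coindm N d e := Coindm (coind_mor_proof p).
Fact coind_mor_fun_linear d e : linear (@coind_mor_fun d e).
Proof. by move=> a p q; apply: coindm_ext => u v g h; apply: (linearP (t u v)). Qed.
Fact coind_mor_lact x y z (f : mor E y z) (m : bm (coindb M) y x) :
  mklinear (@coind_mor_fun_linear z x) (lact (coindb M) f m)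
  = lact (coindb N) f (mklinear (@coind_mor_fun_linear y x) m).
Proof. exact: coindm_ext. Qed.
Fact coind_mor_ract x y w (m : bm (coindb M) y x) (g : mor E w x) :
  mklinear (@coind_mor_fun_linear y w) (ract (coindb M) m g)
  = ract (coindb N) (mklinear (@coind_mor_fun_linear y x) m) g.
Proof. exact: coindm_ext. Qed.
Definition coind_mor : mor (bimodcat E) (coindb M) (coindb N) :=
  @mkbimodmor _ _ _ (coindb M) (coindb N) _ coind_mor_lact coind_mor_ract.
End CoindMor.

Fact coind_mor_linear M N : linear (@coind_mor M N).
Proof. by move=> a s t; apply: bimodmor_ext => d e m; apply: coindm_ext. Qed.
Program Definition coindF : linfunctor (bimodcat C) (bimodcat E) :=
  @LinFunctor k (bimod C) (bimod E) (bimodcat C) (bimodcat E) coindb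
    (fun M N => mklinear (@coind_mor_linear M N)) _ _.
Next Obligation. by move=> M; apply: bimodmor_ext => d e m; apply: coindm_ext. Qed.
Next Obligation. by move=> M N P t s; apply: bimodmor_ext => d e m; apply: coindm_ext. Qed.

Variable Ji : forall x y, {linear mor E (J x) (J y) -> mor C x y}.
Hypothesis JK : forall x y, cancel (fmap J : mor C x y -> mor E (J x) (J y)) (Ji x y).
Hypothesis JiK : forall x y, cancel (Ji x y) (fmap J : mor C x y -> mor E (J x) (J y)).

Section Counit.
Variable N : bimod C.
Definition coind_ev y x (p : bm (resb J (coindb N)) y x) : bm N y x :=
  (p : coindm N (J y) (J x)) y x (idm E (J y)) (idm E (J x)).
Fact coind_ev_linear y x : linear (@coind_ev y x). Proof. by []. Qed.
Fact coind_ev_lact x y z (f : mor C y z) (p : bm (resb J (coindb N)) y x) :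
  mklinear (@coind_ev_linear z x) (lact (resb J (coindb N)) f p)
  = lact N f (mklinear (@coind_ev_linear y x) p).
Proof.
rewrite /= /coind_ev -(coind_lact (coindmP p)) mcompm1.
by rewrite [LHS]/= mcomp1m.
Qed.
Fact coind_ev_ract x y w (p : bm (resb J (coindb N)) y x) (g : mor C w x) :
  mklinear (@coind_ev_linear y w) (ract (resb J (coindb N)) p g)
  = ract N (mklinear (@coind_ev_linear y x) p) g.
Proof.
rewrite /= /coind_ev -(coind_ract (coindmP p)) mcomp1m.
by rewrite [LHS]/= mcompm1.
Qed.
Definition coind_counit : bimodmor (resb J (coindb N)) N :=
  @mkbimodmor _ _ _ (resb J (coindb N)) N _ coind_ev_lact coind_ev_ract.

(** Equivariance gives p(g, h) = g p(1, 1) h once g and h are read in [C], so p is determined by its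
    value at identities; the same formula defines a preimage of any n. *)
Lemma coind_counit_iso : @is_iso k _ (bimodcat C) _ _ coind_counit.
Proof.
apply: bimodmor_iso => y x.
  move=> p q e; apply: coindm_ext => u v g h.
  have evE (r : coindm N (J y) (J x)) : r u v g h = lact N (Ji _ _ g) (ract N (coind_ev r) (Ji _ _ h)).
    rewrite -(coind_ract (coindmP r)) -(coind_lact (coindmP r)) !JiK.
    by rewrite mcomp1m mcompm1.
  by rewrite !evE; congr (lact N _ (ract N _ _)).
move=> n.
pose p : dprod _ := fun u v (g : mor E (J y) (J u)) (h : mor E (J v) (J x)) =>
  lact N (Ji _ _ g) (ract N n (Ji _ _ h)).
have pP : p \in @coind_pred N (J y) (J x).
  apply/asboolP; split.
  - by move=> u v h a g g'; rewrite /p linearP lact_linl.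
  - by move=> u v g a h h'; rewrite /p linearP ract_linr lact_linr.
  - by move=> u w v a g h; rewrite /p (Ji_comp JK JiK) JK lactA.
  - by move=> u v w b g h; rewrite /p (Ji_comp JK JiK) JK ractA lractA.
exists (Coindm pP); rewrite /= /coind_ev /= /p !(Ji1 JK).
by rewrite lact1 ract1.
Qed.
End Counit.

Variable dec : forall e, seq {x : obC & (mor E (J x) e * mor E e (J x))%type}.
Hypothesis decE : forall e,
  \sum_(t <- dec e) mcomp E (projT2 t).1 (projT2 t).2 = idm E e.

Section Unit.
Variable M : bimod E.
Fact coind_unit_proof d e (m : bm M d e) :
  ((fun y x g h => lact M g (ract M m h)) : dprod _) \in @coind_pred (resb J M) d e.
Proof.
apply/asboolP; split.
- by move=> u v h a g g'; apply: (lact_linl (ract M m h) a g g').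
- by move=> u v g a h h'; rewrite ract_linr lact_linr.
- by move=> u w v a g h; apply: (lactA (fmap J a) g (ract M m h)).
- by move=> u v w b g h; rewrite ractA -lractA.
Qed.
Definition coind_unit_fun d e m : bm (coindb (resb J M)) d e :=
  Coindm (@coind_unit_proof d e m).
Fact coind_unit_linear d e : linear (@coind_unit_fun d e).
Proof.
move=> a m n; apply: coindm_ext => u v g h /=.
by rewrite ract_linl lact_linr.
Qed.
Fact coind_unit_lact x y z (f : mor E y z) (m : bm M y x) :
  mklinear (@coind_unit_linear z x) (lact M f m)
  = lact (coindb (resb J M)) f (mklinear (@coind_unit_linear y x) m).
Proof. by apply: coindm_ext => u v g h /=; rewrite lractA lactA. Qed.
Fact coind_unit_ract x y w (m : bm M y x) (g : mor E w x) :
  mklinear (@coind_unit_linear y w) (ract M m g)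
  = ract (coindb (resb J M)) (mklinear (@coind_unit_linear y x) m) g.
Proof. by apply: coindm_ext => u v h h' /=; rewrite ractA. Qed.
Definition coind_unit : bimodmor M (coindb (resb J M)) :=
  @mkbimodmor _ _ _ M (coindb (resb J M)) _ coind_unit_lact coind_unit_ract.

(** Decomposing the identities of d and e writes m as the double sum of u (v m u') v', where v m u'
    is the value at (v, u') of the function attached to m. This shows injectivity, and the same sum
    with p(v, u') in the middle is a preimage of p. *)
Lemma coind_unit_iso : @is_iso k _ (bimodcat E) _ _ coind_unit.
Proof.
apply: bimodmor_iso => d e.
  move=> m n emn.
  have recE (q : bm M d e) : q = \sum_(s <- dec d) \sum_(t <- dec e)
      lact M (projT2 s).1 (ract M ((coind_unit_fun q : coindm _ d e) (projT1 s) (projT1 t)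
        (projT2 s).2 (projT2 t).1) (projT2 t).2).
    rewrite -[LHS]lact1 -decE (linf_sum (lact_linl _)); apply: eq_bigr => s _.
    rewrite -[in LHS](ract1 q) -[in LHS]decE (linf_sum (ract_linr _)) (linf_sum (lact_linr _)).
    by apply: eq_bigr => t _; rewrite /= lactA ractA lractA.
  by rewrite [LHS]recE [RHS]recE (emn : coind_unit_fun m = coind_unit_fun n).
move=> p; have [p1 p2 p3 p4] := coindmP p.
exists (\sum_(s <- dec d) \sum_(t <- dec e)
  lact M (projT2 s).1 (ract M ((p : coindm (resb J M) d e) (projT1 s) (projT1 t)
    (projT2 s).2 (projT2 t).1) (projT2 t).2)).
apply: coindm_ext => u v g h /=.
rewrite (linf_sum (ract_linl _)) (linf_sum (lact_linr _)).
rewrite -[in RHS](decr decE g) (linf_sum (p1 _ _ _)); apply: eq_bigr => s _.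
rewrite (linf_sum (ract_linl _)) (linf_sum (lact_linr _)).
rewrite -[in RHS](decl decE h) (linf_sum (p2 _ _ _)); apply: eq_bigr => t _.
rewrite -[mcomp E g _]JiK p3 -[mcomp E (projT2 t).2 h]JiK p4 /= !JiK.
by rewrite -lractA lactA lractA ractA lractA.
Qed.
End Unit.

Lemma resF_coindF : nat_isomorphic (compfunctor (resF J) coindF) (idfunctor (bimodcat C)).
Proof.
exists coind_counit; split=> [M N t|N]; last exact: coind_counit_iso.
exact: bimodmor_ext.
Qed.

Lemma coindF_resF : nat_isomorphic (compfunctor coindF (resF J)) (idfunctor (bimodcat E)).
Proof.
apply: nat_iso_sym; exists coind_unit; split=> [M N t|M]; last exact: coind_unit_iso.
apply: bimodmor_ext => d e m; apply: coindm_ext => u v g h /=.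
by rewrite bimodmor_lact bimodmor_ract.
Qed.

Lemma resF_equivalence : is_equivalence (resF J).
Proof. by exists coindF; split; [apply: coindF_resF|apply: resF_coindF]. Qed.

Lemma coindF_equivalence : is_equivalence coindF.
Proof. by exists (resF J); split; [apply: resF_coindF|apply: coindF_resF]. Qed.

Lemma res_regbimod : isomorphic (bimodcat C) (resF J (regbimod E)) (regbimod C).
Proof.
apply: isomorphic_sym.
have tl x y z (f : mor C y z) (m : bm (regbimod C) y x) :
    (fmap J : {linear mor C x z -> mor E (J x) (J z)}) (lact (regbimod C) f m)
    = lact (resb J (regbimod E)) f ((fmap J : {linear mor C x y -> _}) m).
  exact: fmap_comp.
have tr x y w (m : bm (regbimod C) y x) (g : mor C w x) :
    (fmap J : {linear mor C w y -> mor E (J w) (J y)}) (ract (regbimod C) m g)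
    = ract (resb J (regbimod E)) ((fmap J : {linear mor C x y -> _}) m) g.
  exact: fmap_comp.
exists (@mkbimodmor _ _ _ (regbimod C) (resb J (regbimod E)) (fun y x => fmap J) tl tr).
apply: bimodmor_iso => y x /=; first exact: can_inj (@JK x y).
by move=> g; exists (Ji _ _ g); apply: JiK.
Qed.

End Coinduction.

(** * The linking category of a Morita equivalence *)

Section Equivalences.
Variables (k : fieldType) (obA obB : Type) (A : lincat k obA) (B : lincat k obB).

Definition fully_faithful (F : linfunctor A B) : Prop := forall x y,
  injective (fmap F : mor A x y -> mor B (F x) (F y)) /\
  forall g : mor B (F x) (F y), exists f : mor A x y, fmap F f = g.

Lemma nat_iso_id_inj (T : linfunctor A A) x y :
  nat_isomorphic T (idfunctor A) ->
  injective (fmap T : mor A x y -> mor A (T x) (T y)).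
Proof.
move=> [t [nt it]] f g e; have [s [_ ts]] := it x.
have := congr1 (mcomp A (t y)) e; rewrite -!nt => /(congr1 (fun h => mcomp A h s)).
by rewrite -!mcompA ts !mcompm1.
Qed.
End Equivalences.

Lemma equivalence_fully_faithful (k : fieldType) (obA obB : Type)
    (A : lincat k obA) (B : lincat k obB) (F : linfunctor A B) :
  is_equivalence F -> fully_faithful F.
Proof.
move=> [G [GF FG]] x y; split.
  by move=> f g e; apply: (nat_iso_id_inj GF); rewrite /= e.
move=> h; have [t [nt it]] := GF.
have [s [st _]] := it y; have [r [rt tr]] := it x.
exists (mcomp A (mcomp A (t y) (fmap G h)) r).
have Gi : injective (fmap G : mor B (F x) (F y) -> mor A (G (F x)) (G (F y))).
  by move=> f g e; apply: (nat_iso_id_inj FG); rewrite /= e.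
(* Fullness of [F] rests on faithfulness of [G]: it is enough to compare G (F f) with G h. *)
set f := mcomp A _ r; apply: Gi.
rewrite -[LHS]mcomp1m -st -mcompA -[mcomp A (t y) _](nt x y f) /= /f.
by rewrite -mcompA rt mcompm1 mcompA st mcomp1m.
Qed.

(** * Left modules: the Yoneda lemma and quotient modules *)

Section Modules.
Variables (k : fieldType) (ob : Type) (A : lincat k ob).
Implicit Types N P : leftmod A.

Definition mact N x y (f : mor A x y) : {linear N x -> N y} := fmap N f.
Definition mapp N P (t : mor (leftmodcat A) N P) x : {linear N x -> P x} := nt_fun t x.

Lemma mact1 N x n : mact N (idm A x) n = n.
Proof. by rewrite /mact fmap1. Qed.
Lemma mact_comp N x y z (g : mor A y z) (f : mor A x y) n :
  mact N (mcomp A g f) n = mact N g (mact N f n).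
Proof. by rewrite /mact fmap_comp. Qed.
Lemma mact_linl N x y n : linear (fun f : mor A x y => mact N f n).
Proof. by move=> a f g; rewrite /mact linearP. Qed.
Lemma mapp_nat N P (t : mor (leftmodcat A) N P) x y (f : mor A x y) n :
  mapp t y (mact N f n) = mact P f (mapp t x n).
Proof.
exact: (esym (congr1 (fun h : {linear N x -> P y} => h n) (nattransP t f))).
Qed.
Lemma mapp_ext N P (t s : mor (leftmodcat A) N P) :
  (forall x n, mapp t x n = mapp s x n) -> t = s.
Proof. by move=> e; apply: nattrans_ext => x; apply: linear_ext => n; apply: e. Qed.
Lemma mapp_comp N P Q (t : mor (leftmodcat A) P Q) (s : mor (leftmodcat A) N P) x n :
  mapp (mcomp (leftmodcat A) t s) x n = mapp t x (mapp s x n).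
Proof. by []. Qed.

Section MakeMorphism.
Variables (N P : leftmod A) (t : forall x, {linear N x -> P x}).
Hypothesis nt : forall x y (f : mor A x y) n, t y (mact N f n) = mact P f (t x n).
Fact mkmodmor_proof : (t : dprod _) \in @natural_pred _ _ _ _ (vectcat k) N P.
Proof. by apply/asboolP => x y f; apply: linear_ext => n; apply/esym/nt. Qed.
Definition mkmodmor : mor (leftmodcat A) N P := NatTrans mkmodmor_proof.
End MakeMorphism.

Fact repm_linear (x y z : ob) :
  linear (fun f : mor A y z => mklinear (mcomp_linr (x := x) f)
    : mor (vectcat k) (mor A x y) (mor A x z)).
Proof. by move=> a f g; apply: linear_ext => h /=; apply: mcomp_linl. Qed.
Program Definition repm (x : ob) : leftmod A :=
  @LinFunctor k ob (lmodType k) A (vectcat k) (fun y => mor A x y)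
    (fun y z => mklinear (@repm_linear x y z)) _ _.
Next Obligation. by move=> x y; apply: linear_ext => f /=; rewrite mcomp1m. Qed.
Next Obligation. by move=> x y z t g f; apply: linear_ext => h /=; rewrite mcompA. Qed.

Definition yoneda N x (n : N x) : mor (leftmodcat A) (repm x) N :=
  @mkmodmor (repm x) N (fun y => mklinear (mact_linl (y := y) n))
    (fun y z f g => mact_comp f g n).

Lemma yoneda_id N x (n : N x) : mapp (yoneda n) x (idm A x) = n.
Proof. exact: mact1. Qed.

Lemma repm_ext N x (s t : mor (leftmodcat A) (repm x) N) :
  mapp s x (idm A x) = mapp t x (idm A x) -> s = t.
Proof.
move=> e; apply: mapp_ext => y f.
have -> : f = mact (repm x) f (idm A x) by rewrite /mact /= mcompm1.
by rewrite !mapp_nat e.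
Qed.

Lemma yoneda_comp N P x (t : mor (leftmodcat A) N P) (n : N x) :
  mcomp (leftmodcat A) t (yoneda n) = yoneda (mapp t x n).
Proof. by apply: repm_ext; rewrite mapp_comp !yoneda_id. Qed.

Lemma yoneda_mcomp x y z (g : mor A y z) (f : mor A x y) :
  @yoneda (repm x) z (mcomp A g f)
  = mcomp (leftmodcat A) (@yoneda (repm x) y f) (@yoneda (repm y) z g).
Proof. by rewrite yoneda_comp. Qed.

Lemma yoneda_idm x :
  @yoneda (repm x) x (idm A x) = idm (leftmodcat A) (repm x).
Proof. by apply: repm_ext; rewrite yoneda_id. Qed.

Lemma yoneda_inj N x : injective (@yoneda N x).
Proof. by move=> m n e; rewrite -[m]yoneda_id e yoneda_id. Qed.

Lemma yoneda_surj N x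
    (t : mor (leftmodcat A) (repm x) N) : exists n, yoneda n = t.
Proof. by exists (mapp t x (idm A x)); apply: repm_ext; rewrite yoneda_id. Qed.

Lemma yoneda_linear N x : linear (@yoneda N x).
Proof. by move=> a m n; apply: mapp_ext => y f; apply: (linearP (mact N f)). Qed.

Section QuotientModule.
Variables (N : leftmod A) (S : forall x, submodClosed (N x)).
Hypothesis stableS : forall x y (f : mor A x y) n, n \in S x -> mact N f n \in S y.

Fact quotm_linear x y :
  linear (fun f : mor A x y => qmap (@stableS x y f) : mor (vectcat k) (quotl (S x)) (quotl (S y))).
Proof.
move=> a f g; apply: linear_ext => q; rewrite -(qreprK q); move: (qrepr q) => n.
transitivity (qmap (@stableS x y (a *: f + g)) (qclass _ n)) => //.
transitivity (a *: qmap (@stableS x y f) (qclass _ n) + qmap (@stableS x y g) (qclass _ n)) => //.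
rewrite [LHS]qmapE (qmapE (@stableS x y f)) (qmapE (@stableS x y g)).
rewrite (mact_linl n a f g); exact: (linearP (@qclass k (N y) (S y))).
Qed.
Program Definition quotm : leftmod A :=
  @LinFunctor k ob (lmodType k) A (vectcat k) (fun x => quotl (S x))
    (fun x y => mklinear (@quotm_linear x y)) _ _.
Next Obligation.
by move=> x; apply: linear_ext => q; rewrite -[q]qreprK [LHS]qmapE mact1.
Qed.
Next Obligation.
move=> x y z g f; apply: linear_ext => q; rewrite -(qreprK q); move: (qrepr q) => n.
transitivity (qmap (@stableS y z g) (qmap (@stableS x y f) (qclass _ n))) => //.
rewrite (qmapE (@stableS x y f)) (qmapE (@stableS y z g)) -mact_comp.
by apply: (qmapE (@stableS x z (mcomp A g f))).
Qed.
Fact quotm_proj_proof x y (f : mor A x y) n :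
  qclass (S y) (mact N f n) = mact quotm f (qclass (S x) n).
Proof. by apply/esym; apply: (qmapE (@stableS x y f)). Qed.
Definition quotm_proj : mor (leftmodcat A) N quotm :=
  @mkmodmor N quotm (fun x => @qclass k (N x) (S x)) quotm_proj_proof.
End QuotientModule.
End Modules.

Section Generation.
Variables (k : fieldType) (obA obB : Type) (A : lincat k obA) (B : lincat k obB).
Variable G : linfunctor (leftmodcat A) (leftmodcat B).
Hypothesis equivG : is_equivalence G.

Inductive generated (N : leftmod A) (x : obB) : G N x -> Prop :=
  Generated y (p : N y) (w : G (repm A y) x) :
    generated (mapp (fmap G (yoneda p)) x w).

Lemma generated_stable N x y (f : mor B x y) (n : G N x) :
  n \in lspan (@generated N x) -> mact (G N) f n \in lspan (@generated N y).
Proof.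
apply: lspan_map => _ [z p w]; apply: lspan_rel.
by rewrite -mapp_nat; apply: Generated.
Qed.

(* The quotient of [G N] by the generated submodule corresponds under the
   equivalence to a quotient of [N] in which every [p : N y] vanishes. *)
Lemma generated_span N x (e : G N x) : e \in lspan (@generated N x).
Proof.
pose q := quotm_proj (@generated_stable N).
have [F [FG GF]] := equivG.
pose Q := quotm (@generated_stable N).
have [s [r [rs _]]] : isomorphic (leftmodcat B) Q (G (F Q)).
  exact: isomorphic_sym (@nat_iso_obj _ _ _ _ _ _ _ Q GF).
have [q' hq'] := (equivalence_fully_faithful equivG N (F Q)).2 (mcomp (leftmodcat B) s q).
have q'0 : q' = 0.
  apply: mapp_ext => y p; rewrite -[p in LHS]yoneda_id -mapp_comp.
  suff -> : mcomp (leftmodcat A) q' (yoneda p) = 0 by [].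
  apply: (equivalence_fully_faithful equivG (repm A y) (F Q)).1.
  rewrite fmap_comp hq' linear0; apply: mapp_ext => z w.
  rewrite !mapp_comp.
  have -> : mapp q z (mapp (fmap G (yoneda p)) z w) = 0.
    rewrite -[0](linear0 (@qclass k _ (lspan (@generated N z)))).
    by apply/qclass_eqP; rewrite subr0; apply: lspan_rel; apply: Generated.
  exact: linear0.
have q0 : q = 0.
  rewrite -[LHS]mcomp1m -rs -mcompA -hq' q'0 linear0.
  exact: (linear_fun0 (mcomp_linr r)).
rewrite -[e]subr0; apply/qclass_eqP; rewrite [RHS]linear0.
exact: (congr1 (fun t : mor (leftmodcat B) (G N) Q => mapp t x e) q0).
Qed.
End Generation.

(** * Finite sums of morphisms that factor through given objects *)

Section FiniteSums.
Variables (k : fieldType) (ob : Type) (B : lincat k ob) (I : Type) (X : I -> ob).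

Definition factor_type a b : Type := {i : I & (mor B (X i) b * mor B a (X i))%type}.

(** The two-sided ideal generated by the identities of the objects [X i]. Generation by [X] means
    that it contains all identities. *)
Definition sum_factor a b (f : mor B a b) : Prop :=
  exists s : seq (factor_type a b),
    \sum_(t <- s) mcomp B (projT2 t).1 (projT2 t).2 = f.

Lemma sum_factor0 a b : sum_factor (0 : mor B a b).
Proof. by exists [::]; rewrite big_nil. Qed.

Lemma sum_factorD a b (f g : mor B a b) :
  sum_factor f -> sum_factor g -> sum_factor (f + g).
Proof. by move=> [s <-] [r <-]; exists (s ++ r); rewrite big_cat. Qed.

Lemma sum_factor_comp i a b (u : mor B (X i) b) (v : mor B a (X i)) :
  sum_factor (mcomp B u v).
Proof. by exists [:: existT _ i (u, v)]; rewrite big_seq1. Qed.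

Lemma sum_factor_idm i : sum_factor (idm B (X i)).
Proof. rewrite -[idm _ _]mcomp1m; exact: sum_factor_comp. Qed.

Lemma sum_factor_mcompl a b c (g : mor B b c) (f : mor B a b) :
  sum_factor f -> sum_factor (mcomp B g f).
Proof.
move=> [s <-].
exists [seq existT _ (projT1 t) (mcomp B g (projT2 t).1, (projT2 t).2) : factor_type a c
  | t <- s].
by rewrite big_map mcomp_sumr; apply: eq_bigr => t _; rewrite mcompA.
Qed.

Lemma sum_factor_mcompr a b c (g : mor B b c) (f : mor B a b) :
  sum_factor g -> sum_factor (mcomp B g f).
Proof.
move=> [s <-].
exists [seq existT _ (projT1 t) ((projT2 t).1, mcomp B (projT2 t).2 f) : factor_type a c
  | t <- s].
by rewrite big_map mcomp_suml; apply: eq_bigr => t _; rewrite mcompA.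
Qed.

Lemma sum_factorZ a b c (f : mor B a b) : sum_factor f -> sum_factor (c *: f).
Proof.
move=> hf; rewrite -[f]mcomp1m -(linfZ (mcomp_linl f)); exact: sum_factor_mcompl.
Qed.

Lemma sum_factor_iso a b : isomorphic B a b ->
  sum_factor (idm B a) -> sum_factor (idm B b).
Proof.
move=> [f [g [gf fg]]] h; rewrite -fg -[f]mcompm1.
by apply: sum_factor_mcompr; apply: sum_factor_mcompl.
Qed.
End FiniteSums.

Lemma sum_factor_fmap (k : fieldType) (obA obB : Type) (A : lincat k obA)
    (B : lincat k obB) (F : linfunctor A B) (I : Type) (X : I -> obA) a b (f : mor A a b) :
  sum_factor X f -> sum_factor (fun i => F (X i)) (fmap F f).
Proof.
move=> [s <-].
exists [seq existT _ (projT1 t) (fmap F (projT2 t).1, fmap F (projT2 t).2)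
  : factor_type B (fun i => F (X i)) (F a) (F b) | t <- s].
rewrite big_map linear_sum.
by apply: eq_bigr => t _ /=; rewrite fmap_comp.
Qed.

(** Put P = F(A(x, -)). A map from A(x, -) to G P is an element of (G P)(x), hence by
    [generated_span] a finite combination of images of elements of the G(B(y, -))(x). So it is a
    finite sum of maps through the G(B(y, -)), which [F] carries back to the B(y, -) up to
    isomorphism. *)
Lemma equivalence_repm (k : fieldType) (obA obB : Type) (A : lincat k obA)
    (B : lincat k obB) (F : linfunctor (leftmodcat A) (leftmodcat B)) x :
  is_equivalence F -> sum_factor (repm B) (idm (leftmodcat B) (F (repm A x))).
Proof.
move=> [G [GF FG]].
have eqG : is_equivalence G by exists F.
have [eta [neta ieta]] := FG.
have [s [t [ts _]]] : isomorphic (leftmodcat A) (repm A x) (G (F (repm A x))).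
  exact: isomorphic_sym (@nat_iso_obj _ _ _ _ _ _ _ (repm A x) GF).
rewrite -fmap1 -ts fmap_comp; apply: sum_factor_mcompl.
set P := F (repm A x) in s t ts *.
have -> : s = yoneda (mapp s x (idm A x)) by apply: repm_ext; rewrite yoneda_id.
have /asboolP := generated_span eqG (mapp s x (idm A x)).
elim=> [|a u v [y p w] _ IH].
  rewrite (linear_fun0 (@yoneda_linear _ _ A (G P) x)) linear0; exact: sum_factor0.
rewrite yoneda_linear linearP; apply: sum_factorD IH; apply: sum_factorZ.
rewrite -yoneda_comp fmap_comp; apply: sum_factor_mcompr.
have [e [ee _]] := ieta P.
(* Naturality of [eta] at [yoneda p] rewrites F (G (yoneda p)) as a composite through B(y, -). *)
rewrite -[fmap F _]mcomp1m -ee -mcompA -[mcomp _ (eta P) _](neta _ _ (yoneda p)).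
by apply: sum_factor_mcompl; apply: sum_factor_comp.
Qed.

(** Apply [F] to the decomposition for the quasi-inverse [G], then transport it along the
    isomorphism of F (G (B(y, -))) with B(y, -). *)
Lemma equivalence_repm_inv (k : fieldType) (obA obB : Type) (A : lincat k obA)
    (B : lincat k obB) (F : linfunctor (leftmodcat A) (leftmodcat B)) y :
  is_equivalence F ->
  sum_factor (fun x => F (repm A x)) (idm (leftmodcat B) (repm B y)).
Proof.
move=> [G [GF FG]]; have eqG : is_equivalence G by exists F.
apply: (sum_factor_iso (@nat_iso_obj _ _ _ _ _ _ _ (repm B y) FG)).
by have := sum_factor_fmap F (equivalence_repm y eqG); rewrite fmap1.
Qed.

Section OppositeFullImage.
Variables (k : fieldType) (ob obE : Type) (B : lincat k ob) (X : obE -> ob).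

Program Definition opfull : lincat k obE :=
  @LinCat k obE (fun a b => mor B (X b) (X a)) (fun a => idm B (X a))
    (fun a b c g f => mcomp B f g) _ _ _ _ _.
Next Obligation. by move=> x y z f; apply: mcomp_linr. Qed.
Next Obligation. by move=> x y z f; apply: mcomp_linl. Qed.
Next Obligation. by move=> x y f; apply: mcompm1. Qed.
Next Obligation. by move=> x y f; apply: mcomp1m. Qed.
Next Obligation. by move=> x y z t h g f; apply/esym/mcompA. Qed.

Lemma sum_factor_opfull (I : Type) (Y : I -> obE) a :
  sum_factor (fun i => X (Y i)) (idm B (X a)) -> sum_factor (B := opfull) Y (idm opfull a).
Proof.
move=> [s hs].
exists [seq existT _ (projT1 t) ((projT2 t).2, (projT2 t).1) : factor_type opfull Y a a | t <- s].
by rewrite big_map.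
Qed.
End OppositeFullImage.

Section Invariance.
Variables (k : fieldType) (obC obE : Type) (C : lincat k obC) (E : lincat k obE).
Variable J : linfunctor C E.

Theorem generating_full_invariance :
  fully_faithful J -> (forall e, sum_factor J (idm E e)) ->
  is_equivalence (resF J) /\ is_equivalence (coindF J) /\
  nat_isomorphic (compfunctor (coindF J) (resF J)) (idfunctor (bimodcat E)) /\
  nat_isomorphic (compfunctor (resF J) (coindF J)) (idfunctor (bimodcat C)) /\
  isomorphic (bimodcat C) (resF J (regbimod E)) (regbimod C) /\
  forall n, nat_isomorphic (compfunctor (HHco C n) (resF J)) (HHco E n) /\
    nat_isomorphic (compfunctor (HHho C n) (resF J)) (HHho E n).
Proof.
move=> ff gen.
pose Ji x y := projT1 (cid (linear_bij (ff x y).1 (ff x y).2)).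
have JK x y : cancel (fmap J) (Ji x y) := (projT2 (cid (linear_bij (ff x y).1 (ff x y).2))).1.
have JiK x y : cancel (Ji x y) (fmap J) := (projT2 (cid (linear_bij (ff x y).1 (ff x y).2))).2.
pose dec e := projT1 (cid (gen e)).
have decE e : \sum_(t <- dec e) mcomp E (projT2 t).1 (projT2 t).2 = idm E e :=
  projT2 (cid (gen e)).
split; first exact: resF_equivalence JK JiK _ decE.
split; first exact: coindF_equivalence JK JiK _ decE.
split; first exact: coindF_resF JiK _ decE.
split; first exact: resF_coindF JK JiK.
split; first exact: res_regbimod JK JiK.
by move=> n; split; [exact: HHco_res JK JiK _ decE _ | exact: HHho_res JK JiK _ decE _].
Qed.
End Invariance.

Section Embeddings.
Variables (k : fieldType) (obC obD : Type) (C : lincat k obC) (D : lincat k obD).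
Variable F : linfunctor (leftmodcat C) (leftmodcat D).

(** The objects are indexed by a disjoint sum, not taken among the modules themselves, so that the
    linking category stays small. *)
Definition linking_module (a : obC + obD) : leftmod D :=
  match a with inl x => F (repm C x) | inr y => repm D y end.
Definition linking_cat : lincat k (obC + obD) := opfull (leftmodcat D) linking_module.

Program Definition linkingl : linfunctor C linking_cat :=
  @LinFunctor k obC (obC + obD) C linking_cat inl
    (fun x y => fmap F \o mklinear (@yoneda_linear k obC C (repm C x) y)) _ _.
Next Obligation. by move=> x; rewrite /= yoneda_idm fmap1. Qed.
Next Obligation. by move=> x y z g f; rewrite /= yoneda_mcomp fmap_comp. Qed.

Program Definition linkingr : linfunctor D linking_cat :=
  @LinFunctor k obD (obC + obD) D linking_cat inr
    (fun x y => mklinear (@yoneda_linear k obD D (repm D x) y)) _ _.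
Next Obligation. by move=> x; apply: yoneda_idm. Qed.
Next Obligation. by move=> x y z g f; apply: yoneda_mcomp. Qed.

Hypothesis equivF : is_equivalence F.

Lemma linkingl_ff : fully_faithful linkingl.
Proof.
move=> x y; have [Fi Fs] := equivalence_fully_faithful equivF (repm C y) (repm C x).
split; first by move=> f g e; apply: (@yoneda_inj k obC C (repm C x)); apply: Fi.
move=> g; have [t <-] := Fs g; have [f <-] := yoneda_surj t.
by exists f.
Qed.

Lemma linkingr_ff : fully_faithful linkingr.
Proof.
by move=> x y; split; [apply: yoneda_inj | apply: yoneda_surj].
Qed.

Lemma linkingl_gen e : sum_factor linkingl (idm linking_cat e).
Proof.
apply: (@sum_factor_opfull k _ _ (leftmodcat D) linking_module).
case: e => [x|y]; last exact: equivalence_repm_inv.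
exact: (@sum_factor_idm k _ _ _ (fun x => F (repm C x)) x).
Qed.

Lemma linkingr_gen e : sum_factor linkingr (idm linking_cat e).
Proof.
apply: (@sum_factor_opfull k _ _ (leftmodcat D) linking_module).
case: e => [x|y]; first exact: equivalence_repm.
exact: (@sum_factor_idm k _ _ _ (repm D) y).
Qed.
End Embeddings.

Theorem theorem2p12 (k : fieldType) (obC obD : Type)
    (C : lincat k obC) (D : lincat k obD) (hCD : morita_equivalent C D) :
  exists Theta : linfunctor (bimodcat D) (bimodcat C),
    is_equivalence Theta /\
    isomorphic (bimodcat C) (Theta (regbimod D)) (regbimod C) /\
    forall n : nat,
      nat_isomorphic (compfunctor (HHco C n) Theta) (HHco D n) /\
      nat_isomorphic (compfunctor (HHho C n) Theta) (HHho D n).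
Proof.
have [F eF] := hCD.
have [eC [_ [_ [_ [regC HHC]]]]] :=
  generating_full_invariance (linkingl_ff eF) (linkingl_gen eF).
have [_ [eD [coresD [rescoD [regD HHD]]]]] :=
  generating_full_invariance (linkingr_ff F) (linkingr_gen eF).
set E := linking_cat F in eC regC HHC eD coresD rescoD regD HHD *.
(* Theta passes through bimodules over the linking category: coinduction from D, then restriction to
   C. *)
exists (compfunctor (resF (linkingl F)) (coindF (linkingr F))); split.
  exact: equivalence_comp.
split.
  apply: isomorphic_trans regC; apply: (fmap_isomorphic (resF (linkingl F))).
  apply: isomorphic_trans (fmap_isomorphic (coindF (linkingr F)) (isomorphic_sym regD)) _.
  exact: (@nat_iso_obj _ _ _ _ _ _ _ (regbimod E) coresD).
(* Both theories agree with the one over the linking category; restriction to D after coinduction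
   from D is the identity up to isomorphism. Cohomology and homology use the same argument. *)
suff transfer (HC : linfunctor (bimodcat C) (vectcat k))
    (HE : linfunctor (bimodcat E) (vectcat k)) (HD : linfunctor (bimodcat D) (vectcat k)) :
    nat_isomorphic (compfunctor HC (resF (linkingl F))) HE ->
    nat_isomorphic (compfunctor HD (resF (linkingr F))) HE ->
    nat_isomorphic (compfunctor HC (compfunctor (resF (linkingl F)) (coindF (linkingr F)))) HD.
  move=> n; have [coC hoC] := HHC n; have [coD hoD] := HHD n.
  by split; [apply: transfer coC coD | apply: transfer hoC hoD].
move=> isoC isoD.
apply: nat_iso_trans (nat_iso_sym (compfunctorA _ _ _)) _.
apply: nat_iso_trans (nat_iso_whiskerr _ (nat_iso_trans isoC (nat_iso_sym isoD))) _.
apply: nat_iso_trans (compfunctorA _ _ _) _.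
apply: nat_iso_trans (nat_iso_whiskerl _ rescoD) _.
exact: compfunctorm1.
Qed.
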